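(* For every $n$ there is a simple arrangement $\mathcal{L}$ of $n$ lines in the plane such that every subset of $\mathcal{L}$ of size $n^{5/6+o(1)}$ (with $o(1)\to 0$ as $n\to\infty$) contains all the lines bounding some cell of the arrangement. In particular, the chromatic number of the hypergraph $\mathcal{H}_{\text{line-cell}}$ of this arrangement is at least $n^{1/6-o(1)}$.
   Context: A simple arrangement of a finite set $\mathcal{L}$ of lines in $\mathbb{R}^2$ is one with no two parallel lines and no three lines through a common point. Its cells are the connected components of $\mathbb{R}^2\setminus\bigcup_{\ell\in\mathcal{L}}\ell$. The hypergraph $\mathcal{H}_{\text{line-cell}}$ has vertex set $\mathcal{L}$ and, for each cell, a hyperedge consisting of the lines that contain a boundary edge of that cell. The chromatic number of a hypergraph is the minimum number of colors in a vertex coloring with no monochromatic hyperedge. *)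

(* Defs.v *)
From Stdlib Require Import Reals Lra List.
Import ListNotations.
Open Scope R_scope.

Record line := mkLine { la : R; lb : R; lc : R; line_nondeg : la <> 0 \/ lb <> 0 }.

Definition pt := (R * R)%type.

Definition on_line (l : line) (p : pt) : Prop :=
  la l * fst p + lb l * snd p = lc l.

Definition dflt_line : line := mkLine 1 0 0 (or_introl R1_neq_R0).

Definition lin (L : list line) (i : nat) : line := nth i L dflt_line.

Definition parallel (l m : line) : Prop := la l * lb m - la m * lb l = 0.

Definition simple_arr (L : list line) : Prop :=
  (forall i j, (i < length L)%nat -> (j < length L)%nat -> i <> j ->
     ~ parallel (lin L i) (lin L j)) /\
  (forall i j k p, (i < length L)%nat -> (j < length L)%nat -> (k < length L)%nat ->
     i <> j -> j <> k -> i <> k ->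
     ~ (on_line (lin L i) p /\ on_line (lin L j) p /\ on_line (lin L k) p)).

Definition off_lines (L : list line) (p : pt) : Prop :=
  forall i, (i < length L)%nat -> ~ on_line (lin L i) p.

(* q lies in the same connected component (= path component, the set being
   open) of R^2 \ union L as p *)
Definition same_cell (L : list line) (p q : pt) : Prop :=
  off_lines L p /\ off_lines L q /\
  exists g : R -> pt,
    continuity (fun t => fst (g t)) /\ continuity (fun t => snd (g t)) /\
    g 0 = p /\ g 1 = q /\ (forall t, 0 <= t <= 1 -> off_lines L (g t)).

Definition in_closure_cell (L : list line) (p z : pt) : Prop :=
  forall eps, 0 < eps -> exists q, same_cell L p q /\
    Rabs (fst q - fst z) < eps /\ Rabs (snd q - snd z) < eps.

(* line i contains a boundary edge of the cell containing p: a nondegenerate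
   segment of line i lies in the closure of the cell (the cell is open and
   disjoint from the line, so this segment lies on the cell's boundary) *)
Definition bounds_cell (L : list line) (i : nat) (p : pt) : Prop :=
  exists a b : pt, a <> b /\ on_line (lin L i) a /\ on_line (lin L i) b /\
    forall t, 0 <= t <= 1 ->
      in_closure_cell L p (fst a + t * (fst b - fst a), snd a + t * (snd b - snd a)).

(* the hyperedge of the cell containing p (p off all lines) is contained in S *)
Definition hyperedge_in (L : list line) (p : pt) (S : nat -> Prop) : Prop :=
  forall i, (i < length L)%nat -> bounds_cell L i p -> S i.

Definition proper_coloring (L : list line) (k : nat) (col : nat -> nat) : Prop :=
  (forall i, (i < length L)%nat -> (col i < k)%nat) /\
  forall p, off_lines L p -> ~ exists c, hyperedge_in L p (fun i => col i = c).

(* Main.v *)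
(** Collinear triples of the integer grid [[n]^3] are plentiful: a set [A] of
    density [d] splits, in each of the about [(d n)^3] short primitive
    directions, into boundedly long pieces of lines, so most of [A] can be packed
    by disjoint collinear triples in that direction.  Two points determine their
    direction, so the union of these packings is a _linear_ 3-uniform hypergraph
    that is nearly regular.  For such a hypergraph a two-stage greedy fingerprint
    (first a graph of bounded degree made of links of vertices of [I], then
    neighbourhoods in that graph) captures each line-free set [I] in a container
    that misses a fixed proportion of [A].  With [n = q^3], iterating down to size
    [O(q^8)] costs fingerprints of length [O(q^5)] up to logarithms.

    A random choice of about [q^6] grid points contains few collinear quadruples,
    and, by the union bound over containers, no line-free set of size [q^5] up to
    logarithms.  After deleting the quadruples, each larger set contains a
    collinear triple whose line carries no further chosen point.

    Projecting generically to the plane and dualising turns such triples into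
    points lying on exactly three lines.  Moving the line of slope [x] by
    [e * x^2] makes the arrangement simple, and each of these points opens into
    a small triangle that no other line meets. *)
Require Import Defs.
From Stdlib Require Import Reals Lra List ZArith Lia Classical.
From mathcomp Require all_boot zify.
Open Scope R_scope.

Definition collinear (d : nat) (p q r : nat -> Z) : Prop :=
  forall a b, (a < d)%nat -> (b < d)%nat ->
    ((q a - p a) * (r b - p b) = (q b - p b) * (r a - p a))%Z.

Definition distinct_points (d N : nat) (P : nat -> nat -> Z) : Prop :=
  forall i j, (i < N)%nat -> (j < N)%nat ->
    (forall a, (a < d)%nat -> P i a = P j a) -> i = j.

Definition exact_triple (d N : nat) (P : nat -> nat -> Z) (i j k : nat) : Prop :=
  ((i < N)%nat /\ (j < N)%nat /\ (k < N)%nat) /\ (i <> j /\ j <> k /\ i <> k) /\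
  collinear d (P i) (P j) (P k) /\
  forall t, (t < N)%nat -> collinear d (P i) (P j) (P t) -> t = i \/ t = j \/ t = k.

Module GridTriples.

Import all_boot zify.
Set Implicit Arguments. Unset Strict Implicit. Unset Printing Implicit Defensive.
Local Open Scope nat_scope.

(** * Counting in finite sets *)

Lemma leq_wexp2r (m n e : nat) : m <= n -> m ^ e <= n ^ e.
Proof. by case: e => // e; rewrite leq_exp2r. Qed.

Lemma leq_card_bigcup (I U : finType) (P : {pred I}) (F : I -> {set U}) :
  #|\bigcup_(i in P) F i| <= \sum_(i in P) #|F i|.
Proof.
elim/big_ind2: _ => [|X a Y b leXa leYb|//]; first by rewrite cards0.
by apply: leq_trans (leq_card_setU _ _) _; apply: leq_add.
Qed.

Lemma card_bigcup_disjoint (I U : finType) (P : {pred I}) (F : I -> {set U}) :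
  (forall i j u, i \in P -> j \in P -> u \in F i -> u \in F j -> i = j) ->
  #|\bigcup_(i in P) F i| = \sum_(i in P) #|F i|.
Proof.
move=> inj; pose FP i := if i \in P then F i else set0.
have memFP i u : u \in FP i -> i \in P /\ u \in F i.
  by rewrite /FP; case: ifP => iP; rewrite ?inE.
rewrite big_mkcond [RHS]big_mkcond -sum1_card /=.
rewrite (partition_disjoint_bigcup addn (F := FP)) => [|i j ne_ij].
  by apply: eq_bigr => i _; rewrite sum1_card /FP; case: ifP; rewrite ?cards0.
apply/pred0P => u /=; apply/negP => /andP[/memFP[iP iu] /memFP[jP ju]].
by move: ne_ij; rewrite (inj i j u) ?eqxx.
Qed.

Lemma sum_mem_const (T : finType) (X : {set T}) (c : nat) :
  \sum_x (x \in X) * c = #|X| * c.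
Proof.
rewrite -sum_nat_const [RHS]big_mkcond; apply: eq_bigr => x _.
by case: (x \in X); rewrite ?mul1n.
Qed.

Definition section (T U : finType) (B : {set T * U}) (x : T) : {set U} :=
  [set y | (x, y) \in B].

Lemma card_section_in (T U : finType) (B : {set T * U}) (X : {set T}) :
  #|[set p in B | p.1 \in X]| = \sum_(x in X) #|section B x|.
Proof.
have -> : [set p in B | p.1 \in X] = \bigcup_(x in X) setX [set x] (section B x).
  apply/setP => -[x y]; rewrite !inE /=; apply/andP/bigcupP => [[xyB xX]|[z zX]].
    by exists x; rewrite // !inE eqxx.
  by rewrite !inE /= => /andP[/eqP-> ->].
rewrite card_bigcup_disjoint => [|x x' [z y] _ _].
  by apply: eq_bigr => x _; rewrite cardsX cards1 mul1n.
by rewrite !inE /= => /andP[/eqP<- _] /andP[/eqP<- _].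
Qed.

Lemma card_section (T U : finType) (B : {set T * U}) : #|B| = \sum_x #|section B x|.
Proof.
transitivity #|[set p in B | p.1 \in [set: T]]|.
  by apply: eq_card => p; rewrite !inE andbT.
by rewrite card_section_in; apply: eq_bigl => x; rewrite inE.
Qed.

Lemma card_section_supported (T U : finType) (B : {set T * U}) (X : {set T}) :
  (forall x y, (x, y) \in B -> x \in X) -> #|B| = \sum_(x in X) #|section B x|.
Proof.
move=> BX; rewrite -card_section_in; apply: eq_card => -[x y].
by rewrite !inE /=; apply/idP/andP => [xyB|[]//]; split=> //; apply: BX xyB.
Qed.

Lemma sum_card_section_le (T U : finType) (B : {set T * U}) (X : {set T}) (d : nat) :
  (forall x, #|section B x| <= d) -> \sum_(x in X) #|section B x| <= #|X| * d.
Proof. by move=> le_d; rewrite -sum_nat_const; apply: leq_sum. Qed.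

Lemma sum_section_setI_sym (T : finType) (G : {set T * T}) (W : {set T}) :
  (forall x y, (x, y) \in G -> (y, x) \in G) ->
  \sum_x #|section G x :&: W| = \sum_(y in W) #|section G y|.
Proof.
move=> symG; pose swap (p : T * T) := (p.2, p.1).
have swapK : injective swap by move=> [x y] [x' y'] [-> ->].
rewrite -card_section_in -(card_preimset _ swapK) card_section.
apply: eq_bigr => x _; apply: eq_card => y; rewrite !inE /=.
by congr (_ && _); apply/idP/idP => /symG.
Qed.

Lemma cards3 (T : finType) (x y z : T) :
  (#|[set x; y; z]| == 3) = [&& x != y, y != z & x != z].
Proof.
rewrite setUC cardsU1 cards2 !inE negb_or ![z == _]eq_sym.
by case: (x != y); case: (x != z); case: (y != z).
Qed.

Lemma card_bseq_le (T : finType) (t : nat) : #|{bseq t of T}| <= #|T|.+1 ^ t.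
Proof.
rewrite card_bseq; elim: t => [|t IH]; first by rewrite big_ord1.
by rewrite big_ord_recr /= [leqRHS]expnS mulSn leq_add // expnS leq_mul2l leq_wexp2r ?orbT.
Qed.

(** * Containers for linear triple systems *)

Definition grow (T U : finType) (gain : {set U} -> T -> {set U}) (s : seq T) : {set U} :=
  foldr (fun v G => G :|: gain G v) set0 s.

Lemma mem_grow (T U : finType) (gain : {set U} -> T -> {set U}) s u :
  u \in grow gain s -> exists2 v, v \in s & exists G, u \in gain G v.
Proof.
elim: s => [|v s IH] /=; first by rewrite inE.
rewrite inE => /orP[/IH[w ws uw]|uv]; first by exists w; rewrite // inE ws orbT.
by exists v; [rewrite mem_head | exists (grow gain s)].
Qed.

Lemma greedy_fingerprint (T U : finType) (gain : {set U} -> T -> {set U})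
    (a b : nat) (I : {set T}) :
  (forall (G : {set U}) v, [disjoint G & gain G v]) -> 0 < a ->
  exists s, [/\ {subset s <= I}, a * size s <= b * #|grow gain s| &
    forall v, v \in I -> b * #|gain (grow gain s) v| < a].
Proof.
move=> disj a_gt0.
suff saturate n s : {subset s <= I} -> a * size s <= b * #|grow gain s| ->
    b * #|U| < n + b * #|grow gain s| -> exists s, [/\ {subset s <= I},
    a * size s <= b * #|grow gain s| &
    forall v, v \in I -> b * #|gain (grow gain s) v| < a].
  by apply: (saturate (b * #|U|).+1 [::]) => //=; [rewrite muln0 | rewrite cards0; lia].
elim: n s => [|n IH] s sI size_s room.
  by move: room; rewrite add0n ltnNge leq_mul2l max_card orbT.
case: (boolP [exists v in I, a <= b * #|gain (grow gain s) v|]) => [|stuck]; last first.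
  exists s; split => // v vI; rewrite ltnNge; apply: contra stuck => le_a.
  by apply/existsP; exists v; rewrite vI.
case/existsP => v /andP[vI le_a].
have card_grow : #|grow gain (v :: s)| = #|grow gain s| + #|gain (grow gain s) v|.
  by rewrite /= cardsU disjoint_setI0 // cards0 subn0.
apply: (IH (v :: s)) => [w||].
- by rewrite inE => /orP[/eqP-> //|/sI].
- by rewrite card_grow mulnS mulnDr addnC leq_add.
- by rewrite card_grow mulnDr; lia.
Qed.

Definition link (T : finType) (H : {set {set T}}) (v : T) : {set T * T} :=
  [set p | [set v; p.1; p.2] \in H].

Definition independent (T : finType) (H : {set {set T}}) (I : {set T}) : Prop :=
  forall B, B \in H -> ~~ (B \subset I).

Definition covers (T : finType) (free : {set T} -> Prop) (A : {set T})
    (F : {set {set T}}) : Prop :=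
  forall I : {set T}, I \subset A -> free I -> exists2 C, C \in F & I \subset C.

Record linear_triple_system (T : finType) (A : {set T}) (H : {set {set T}}) : Prop := {
  triple_sub : forall B, B \in H -> B \subset A;
  triple_card : forall B, B \in H -> #|B| = 3;
  triple_inter : forall B C x y, B \in H -> C \in H -> x != y ->
    x \in B -> y \in B -> x \in C -> y \in C -> B = C }.

Definition saturated (T : finType) (D : nat) (G : {set T * T}) : {set T} :=
  [set x | D <= #|section G x|].

Definition new_pairs (T : finType) (H : {set {set T}}) (D : nat)
    (G : {set T * T}) (v : T) : {set T * T} :=
  [set p in link H v | [&& p \notin G, p.1 \notin saturated D G
                         & p.2 \notin saturated D G]].

Definition new_nbrs (T : finType) (G : {set T * T}) (W : {set T}) (u : T) : {set T} :=
  section G u :\: W.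

(* The two cores below contain [I] when [s] is a greedy fingerprint of [I], but
   depend on [I] only through [s]. *)
Definition pair_core (T : finType) (A : {set T}) (H : {set {set T}}) (Q D : nat)
    (s : seq T) : {set T} :=
  [set v in A | 4 * #|new_pairs H D (grow (new_pairs H D) s) v| < Q].

Definition nbr_core (T : finType) (A : {set T}) (G : {set T * T}) (D : nat)
    (s : seq T) : {set T} :=
  [set v in A :\: grow (new_nbrs G) s | 24 * #|new_nbrs G (grow (new_nbrs G) s) v| < D].

Section Links.
Variables (T : finType) (A : {set T}) (H : {set {set T}}).
Hypothesis linH : linear_triple_system A H.
Implicit Types (v x y : T) (G : {set T * T}) (s : seq T).

Lemma mem_linkC v x y : ((x, y) \in link H v) = ((y, x) \in link H v).
Proof. by rewrite !inE /= setUAC. Qed.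

Lemma mem_link_exchange v x y : ((x, y) \in link H v) = ((v, y) \in link H x).
Proof. by rewrite !inE /= [[set v; x]]setUC. Qed.

Lemma link_neq v x y : (x, y) \in link H v -> [&& v != x, x != y & v != y].
Proof. by rewrite inE => /(triple_card linH)/eqP; rewrite cards3. Qed.

Lemma link_sub v x y : (x, y) \in link H v -> [/\ v \in A, x \in A & y \in A].
Proof.
by rewrite inE => /(triple_sub linH)/subsetP sub; split; apply: sub; rewrite !inE eqxx ?orbT.
Qed.

Lemma link_inj v w x y : (x, y) \in link H v -> (x, y) \in link H w -> v = w.
Proof.
move=> vL wL; have /and3P[vx xy vy] := link_neq vL; move: vL wL; rewrite !inE /= => vH wH.
have : v \in [set w; x; y].
  by rewrite -(triple_inter linH vH wH xy) !inE eqxx ?orbT.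
by rewrite !inE (negbTE vx) (negbTE vy) !orbF => /eqP.
Qed.

Lemma sum_card_link_setI G : \sum_v #|link H v :&: G| <= #|G|.
Proof.
rewrite -(card_bigcup_disjoint (P := predT)) => [|v w [x y] _ _]; last first.
  by rewrite !in_setI => /andP[vL _] /andP[wL _]; apply: link_inj vL wL.
by apply: subset_leq_card; apply/bigcupsP => v _; apply: subsetIr.
Qed.

Lemma sum_card_link_fst (X : {set T}) :
  \sum_v #|[set p in link H v | p.1 \in X]| = \sum_(x in X) #|link H x|.
Proof.
under eq_bigr => v _ do rewrite card_section_in.
rewrite exchange_big /=; apply: eq_bigr => x _; rewrite [RHS]card_section.
apply: eq_bigr => v _; apply: eq_card => y.
by rewrite [LHS]in_set mem_link_exchange [RHS]in_set.
Qed.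

Lemma card_link_snd v (X : {set T}) :
  #|[set p in link H v | p.2 \in X]| = #|[set p in link H v | p.1 \in X]|.
Proof.
pose swap (p : T * T) := (p.2, p.1).
have swapK : injective swap by move=> [x y] [x' y'] [-> ->].
rewrite -(card_preimset _ swapK); apply: eq_card => -[x y].
by rewrite !inE /= setUAC.
Qed.

Section GrownGraph.
Variables (D : nat) (s : seq T).
Hypothesis D_gt0 : 0 < D.
Let G := grow (new_pairs H D) s.

Lemma mem_grow_pairs x y : (x, y) \in G -> exists2 v, v \in s & (x, y) \in link H v.
Proof. by case/mem_grow => v vs [K]; rewrite inE => /andP[xyL _]; exists v. Qed.

Lemma grow_pairs_sub x y : (x, y) \in G -> x \in A.
Proof. by case/mem_grow_pairs => v _ /link_sub[]. Qed.

Lemma grow_pairs_sym x y : (x, y) \in G -> (y, x) \in G.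
Proof.
rewrite /G; elim: s x y => [|v r IH] x y /=; first by rewrite inE.
set K := grow _ r in IH *.
have symK a b : ((a, b) \in K) = ((b, a) \in K) by apply/idP/idP; apply: IH.
rewrite !in_setU ![_ \in new_pairs _ _ _ _]in_set symK mem_linkC /=.
by rewrite [(_ \notin _) && (_ \notin _)]andbC.
Qed.

Lemma grow_pairs_degree x : #|section G x| <= D.
Proof.
rewrite /G; elim: s => [|v r IH] /=.
  by rewrite (_ : section _ _ = set0) ?cards0 //; apply/setP => y; rewrite !inE.
set K := grow _ r in IH *.
have -> : section (K :|: new_pairs H D K v) x = section K x :|: section (new_pairs H D K v) x.
  by apply/setP => y; rewrite !in_set.
case: (leqP D #|section K x|) => [full|room].
  rewrite (_ : section (new_pairs H D K v) x = set0) ?setU0 //.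
  by apply/setP => y; rewrite !in_set /= full !andbF.
apply: leq_trans (leq_card_setU _ _) _.
suff : #|section (new_pairs H D K v) x| <= 1 by lia.
apply/card_le1_eqP => y y'; rewrite !in_set => /andP[xyv _] /andP[xyv' _].
have to_link z : [set v; x; z] \in H -> (v, x) \in link H z.
  by move=> vxz; rewrite -mem_link_exchange mem_linkC inE.
by apply: link_inj (to_link _ xyv') (to_link _ xyv).
Qed.

Lemma card_saturated : #|saturated D G| * D <= #|G|.
Proof.
rewrite [#|G|]card_section [leqRHS](bigID (mem (saturated D G))) /= -sum_nat_const.
by apply: leq_trans (leq_addr _ _); apply: leq_sum => x; rewrite in_set.
Qed.

End GrownGraph.

Section PairCore.
Variables (Q D : nat) (s : seq T).
Hypothesis link_le : forall v, #|link H v| <= 2 * Q.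
Let G := grow (new_pairs H D) s.
Let C := pair_core A H Q D s.

Lemma pair_core_sub : C \subset A.
Proof. by apply/subsetP => v; rewrite inE => /andP[]. Qed.

Lemma card_link_split v :
  4 * #|link H v| <= 4 * (#|link H v :&: G| +
      2 * #|[set p in link H v | p.1 \in saturated D G]|) +
    ((v \in C) * Q + (v \in A :\: C) * (8 * Q)).
Proof.
case: (boolP (v \in A)) => vA; last first.
  rewrite (_ : link H v = set0) ?cards0 //; apply/setP => -[x y]; rewrite in_set0.
  by apply: contraNF vA => /link_sub[].
rewrite in_setD vA andbT; case: (boolP (v \in C)) => [vC|_]; last first.
  by have := link_le v; lia.
have new_lt : 4 * #|new_pairs H D G v| < Q by move: vC; rewrite in_set => /andP[].
have : #|link H v| <= #|new_pairs H D G v| + #|link H v :&: G| +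
    #|[set p in link H v | p.1 \in saturated D G]| +
    #|[set p in link H v | p.2 \in saturated D G]|.
  have cover : link H v \subset new_pairs H D G v :|: (link H v :&: G) :|:
      [set p in link H v | p.1 \in saturated D G] :|:
      [set p in link H v | p.2 \in saturated D G].
    apply/subsetP => p pL; rewrite !in_setU in_setI ![p \in [set _ in _ | _]]in_set pL /=.
    by case: (p \in G); case: (p.1 \in saturated D G); case: (p.2 \in saturated D G).
  apply: leq_trans (subset_leq_card cover) _.
  do 2 (apply: leq_trans (leq_card_setU _ _) _; rewrite leq_add2r).
  exact: leq_card_setU.
by rewrite card_link_snd; lia.
Qed.

(* If few vertices leave the core, most link pairs lie in the grown graph or meet
   one of its saturated vertices. *)
Lemma pair_core_graph_dense :
  0 < D -> D <= 2 * Q -> Q * #|A| <= \sum_v #|link H v| ->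
  8 * #|A :\: C| < #|A| -> D * #|A| <= 12 * #|G|.
Proof.
move=> D_gt0 DQ mean few.
have sum_split : 4 * (Q * #|A|) <= 4 * (#|G| + 2 * (#|saturated D G| * (2 * Q))) +
    (#|C| * Q + #|A :\: C| * (8 * Q)).
  apply: leq_trans (leq_mul (leqnn 4) mean) _; rewrite big_distrr /=.
  apply: leq_trans (@leq_sum _ _ xpredT _ _ (fun v _ => card_link_split v)) _.
  rewrite big_split /= [X in _ + X]big_split /= !sum_mem_const leq_add2r.
  rewrite -big_distrr leq_mul2l /= big_split /= -big_distrr /= sum_card_link_fst.
  rewrite leq_add ?sum_card_link_setI // leq_mul2l /= -sum_nat_const.
  by apply: leq_sum => v _; apply: link_le.
have C_le : #|C| * Q <= #|A| * Q by rewrite leq_mul2r subset_leq_card ?orbT ?pair_core_sub.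
have sat_le : #|saturated D G| * D * Q <= #|G| * Q by rewrite leq_mul2r card_saturated orbT.
have Q_gt0 : 0 < Q by lia.
have half_le : Q * #|A| <= 2 * #|G| + 8 * Q * #|saturated D G| by nia.
have : Q * (D * #|A|) <= Q * (12 * #|G|) by nia.
by rewrite leq_pmul2l.
Qed.

Lemma pair_core_covers (t : nat) (I : {set T}) :
  0 < Q -> 0 < D -> 4 * #|A| * D <= Q * t -> I \subset A ->
  exists r, [/\ {subset r <= I}, size r <= t & I \subset pair_core A H Q D r].
Proof.
move=> Q_gt0 D_gt0 room IA.
have [|r [rI size_r few]] := @greedy_fingerprint _ _ (new_pairs H D) Q 4 I _ Q_gt0.
  move=> K v; rewrite disjoint_sym disjoint_subset; apply/subsetP => p.
  by rewrite !in_set => /and3P[].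
exists r; split=> //; last by apply/subsetP => v vI; rewrite in_set (subsetP IA) ?few.
rewrite -(leq_pmul2l Q_gt0) (leq_trans size_r) // (leq_trans _ room) // -mulnA leq_mul2l /=.
rewrite (card_section_supported (@grow_pairs_sub _ _)).
exact: sum_card_section_le (grow_pairs_degree r D_gt0).
Qed.

End PairCore.
End Links.

Section Graphs.
Variables (T : finType) (A : {set T}) (G : {set T * T}) (D : nat).
Hypothesis G_sym : forall x y, (x, y) \in G -> (y, x) \in G.
Hypothesis G_sub : forall x y, (x, y) \in G -> x \in A.

Lemma grow_nbrs_sub s : grow (new_nbrs G) s \subset A.
Proof.
by apply/subsetP => x /mem_grow[u _ [K]]; rewrite !in_set => /andP[_ /G_sym /G_sub].
Qed.

Lemma nbr_core_sub s : nbr_core A G D s \subset A.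
Proof. by apply/subsetP => v; rewrite !in_set => /andP[/andP[]]. Qed.

Lemma card_nbr_core s :
  (forall x, #|section G x| <= D) -> 0 < D -> D * #|A| <= 12 * #|G| ->
  #|A| <= 48 * #|A :\: nbr_core A G D s|.
Proof.
move=> degree_le D_gt0 dense; set C := nbr_core A G D s; pose W := grow (new_nbrs G) s.
have degree_split x : 24 * #|section G x| <=
    24 * #|section G x :&: W| + ((x \in C) * D + (x \in A :\: C) * (24 * D)).
  case: (boolP (x \in A)) => xA; last first.
    rewrite (_ : section G x = set0) ?cards0 //; apply/setP => y; rewrite in_set in_set0.
    by apply: contraNF xA => /G_sub.
  rewrite in_setD xA andbT; case: (boolP (x \in C)) => [xC|_]; last first.
    by have := degree_le x; lia.
  have : 24 * #|section G x :\: W| < D by move: xC; rewrite in_set => /andP[].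
  by rewrite -[#|section G x|](cardsID W); lia.
have sum_split : 24 * #|G| <= 24 * (#|W| * D) + (#|C| * D + #|A :\: C| * (24 * D)).
  rewrite card_section big_distrr /=.
  apply: leq_trans (@leq_sum _ _ xpredT _ _ (fun x _ => degree_split x)) _.
  rewrite big_split /= [X in _ + X]big_split /= !sum_mem_const leq_add2r -big_distrr leq_mul2l.
  by rewrite sum_section_setI_sym // sum_card_section_le.
have W_le : #|W| * D <= #|A :\: C| * D.
  rewrite leq_mul2r subset_leq_card ?orbT //; apply/subsetP => x xW.
  by rewrite in_setD in_set in_setD xW (subsetP (grow_nbrs_sub s)).
have C_le : #|C| * D <= #|A| * D by rewrite leq_mul2r subset_leq_card ?nbr_core_sub ?orbT.
by rewrite -(leq_pmul2l D_gt0); lia.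
Qed.

Lemma nbr_core_covers (t : nat) (I : {set T}) :
  0 < D -> 24 * #|A| <= D * t -> I \subset A ->
  (forall x y, (x, y) \in G -> x \in I -> y \notin I) ->
  exists s, [/\ {subset s <= I}, size s <= t & I \subset nbr_core A G D s].
Proof.
move=> D_gt0 room IA indep.
have [|s [sI size_s few]] := @greedy_fingerprint _ _ (new_nbrs G) D 24 I _ D_gt0.
  move=> K v; rewrite disjoint_sym disjoint_subset; apply/subsetP => x.
  by rewrite !in_set => /andP[].
exists s; split=> //.
  rewrite -(leq_pmul2l D_gt0) (leq_trans size_s) // (leq_trans _ room) // leq_mul2l.
  by rewrite subset_leq_card ?grow_nbrs_sub.
apply/subsetP => v vI; rewrite in_set in_setD (subsetP IA) // few // !andbT.
apply: contraL vI => /mem_grow[u us [K]]; rewrite !in_set => /andP[_ uv].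
exact: indep uv (sI _ us).
Qed.

End Graphs.

Definition container (T : finType) (A : {set T}) (H : {set {set T}}) (Q D : nat)
    (r s : seq T) : {set T} :=
  if 8 * #|A :\: pair_core A H Q D r| < #|A|
  then nbr_core A (grow (new_pairs H D) r) D s else pair_core A H Q D r.

Section Containers.
Variables (T : finType) (A : {set T}) (H : {set {set T}}) (Q D : nat).
Hypothesis linH : linear_triple_system A H.
Hypothesis link_le : forall v, #|link H v| <= 2 * Q.
Hypothesis link_mean : Q * #|A| <= \sum_v #|link H v|.
Hypothesis D_gt0 : 0 < D.
Hypothesis D_le : D <= 2 * Q.

Lemma card_container r s : 48 * #|container A H Q D r s| <= 47 * #|A|.
Proof.
have misses (C : {set T}) : C \subset A -> #|A| <= 48 * #|A :\: C| -> 48 * #|C| <= 47 * #|A|.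
  by move=> CA; have := subset_leq_card CA; rewrite cardsD (setIidPr CA); lia.
rewrite /container; case: ltnP => [few|many]; last first.
  by apply: misses (pair_core_sub A H Q D r) _; lia.
apply: misses (nbr_core_sub _ _ _ _) _.
apply: card_nbr_core => //.
- exact: grow_pairs_sym.
- exact: (grow_pairs_sub linH).
- exact: (grow_pairs_degree linH).
- exact: (pair_core_graph_dense linH).
Qed.

Lemma container_covers (t : nat) (I : {set T}) :
  4 * #|A| * D <= Q * t -> 24 * #|A| <= D * t -> I \subset A -> independent H I ->
  exists r s, [/\ size r <= t, size s <= t & I \subset container A H Q D r s].
Proof.
move=> room_r room_s IA indep; have Q_gt0 : 0 < Q by lia.
have [r [rI size_r Ir]] := pair_core_covers linH Q_gt0 D_gt0 room_r IA.
have G_indep x y : (x, y) \in grow (new_pairs H D) r -> x \in I -> y \notin I.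
  case/mem_grow_pairs => v /rI vI; rewrite inE => /indep sub xI.
  by apply: contra sub => yI; apply/subsetP => z; rewrite !inE => /orP[/orP[]|] /eqP->.
have [s [_ size_s Is]] := nbr_core_covers (@grow_pairs_sym _ _ _ _)
  (@grow_pairs_sub _ _ _ linH _ _) D_gt0 room_s IA G_indep.
by exists r, s; split=> //; rewrite /container; case: ifP.
Qed.

Theorem linear_system_containers (t : nat) :
  4 * #|A| * D <= Q * t -> 24 * #|A| <= D * t ->
  exists F : {set {set T}}, [/\ #|F| <= #|T|.+1 ^ (2 * t),
    forall C, C \in F -> 48 * #|C| <= 47 * #|A| & covers (independent H) A F].
Proof.
move=> room_r room_s.
exists [set container A H Q D u.1 u.2 | u : {bseq t of T} * {bseq t of T}]; split.
- apply: leq_trans (leq_imset_card _ _) _.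
  by rewrite card_prod mul2n -addnn expnD leq_mul ?card_bseq_le.
- by move=> _ /imsetP[u _ ->]; apply: card_container.
- move=> I IA indep.
  have [r [s [size_r size_s cover]]] := container_covers room_r room_s IA indep.
  exists (container A H Q D r s) => //.
  by apply/imsetP; exists (Bseq size_r, Bseq size_s).
Qed.

End Containers.

Section Iteration.
Variables (T : finType) (free : {set T} -> Prop) (a b bound M : nat).
Hypotheses (b_gt0 : 0 < b) (M_gt0 : 0 < M).
Hypothesis shrink : forall A : {set T}, bound < #|A| ->
  exists F : {set {set T}}, [/\ #|F| <= M, forall C, C \in F -> b * #|C| <= a * #|A| &
    covers free A F].

Theorem iterated_containers (j : nat) (A : {set T}) : a ^ j * #|A| <= b ^ j * bound ->
  exists F : {set {set T}}, [/\ #|F| <= M ^ j,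
    forall C, C \in F -> #|C| <= bound & covers free A F].
Proof.
elim: j A => [|j IH] A large.
  exists [set A]; split=> [|C|I IA _]; rewrite ?cards1 //; last by exists A; rewrite ?inE.
  by rewrite inE => /eqP->; rewrite !expn0 !mul1n in large.
case: (leqP #|A| bound) => [small|big].
  exists [set A]; split=> [|C|I IA _]; first by rewrite cards1 expn_gt0 M_gt0.
    by rewrite inE => /eqP->.
  by exists A; rewrite ?inE.
have [F [card_F shrink_F cover_F]] := shrink big.
have /fin_all_exists[G GP] C : exists G : {set {set T}}, C \in F ->
    [/\ #|G| <= M ^ j, forall C', C' \in G -> #|C'| <= bound & covers free C G].
  case: (boolP (C \in F)) => CF; last by exists set0.
  have [|G GP] := IH C; last by exists G.
  have : a ^ j * (b * #|C|) <= a ^ j * (a * #|A|) by rewrite leq_mul2l shrink_F ?orbT.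
  rewrite -[_ <= _ * bound](leq_pmul2l b_gt0); move: large; rewrite !(expnS _ j).
  by move: (a ^ j) (b ^ j) => aj bj; lia.
exists (\bigcup_(C in F) G C); split.
- apply: leq_trans (leq_card_bigcup _ _) _; rewrite expnS.
  apply: leq_trans (leq_mul card_F (leqnn _)); rewrite -sum_nat_const.
  by apply: leq_sum => C /GP[].
- by move=> C /bigcupP[C' /GP[_ small _]]; apply: small.
- move=> I IA freeI; have [C CF IC] := cover_F _ IA freeI.
  have [_ _ cover_G] := GP _ CF; have [C' C'G IC'] := cover_G _ IC freeI.
  by exists C' => //; apply/bigcupP; exists C.
Qed.

End Iteration.

(** * Packing fibers by triples *)

Lemma card_le_fibers (T L : finType) (f : T -> L) (A : {set T}) (d : nat) :
  (forall l, #|[set x in A | f x == l]| <= d) -> #|A| <= #|f @: A| * d.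
Proof.
move=> le_d; rewrite -sum1_card (partition_big_imset f) /= -sum_nat_const.
apply: leq_sum => l _; apply: leq_trans (le_d l); rewrite sum1_card.
by apply: eq_leq; apply: eq_card => x; rewrite !inE.
Qed.

Definition fiber_packing (T L : finType) (f : T -> L) (A : {set T})
    (P : {set {set T}}) : bool :=
  trivIset P && [forall B in P, [&& B \subset A, #|B| == 3
                                  & [forall x in B, forall y in B, f x == f y]]].

Section FiberPacking.
Variables (T L : finType) (f : T -> L) (A : {set T}).
Implicit Types (P : {set {set T}}) (B : {set T}).

Lemma fiber_packing_block P B : fiber_packing f A P -> B \in P ->
  [/\ B \subset A, #|B| = 3 & {in B &, forall x y, f x = f y}].
Proof.
case/andP=> _ /forallP/(_ B)/implyP block /block /and3P[BA /eqP B3 /forall_inP constB].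
by split=> // x y xB yB; apply/eqP; have /forall_inP := constB x xB; apply.
Qed.

Lemma fiber_packing_inter P B C x :
  fiber_packing f A P -> B \in P -> C \in P -> x \in B -> x \in C -> B = C.
Proof.
move=> /andP[/trivIsetP triv _] BP CP xB xC; apply: contraTeq xC => neq.
by have := triv _ _ BP CP neq; rewrite disjoint_sym => /disjointFl->.
Qed.

Lemma exists_fiber_packing :
  exists2 P, fiber_packing f A P & #|A| <= #|cover P| + 2 * #|f @: A|.
Proof.
have pack0 : fiber_packing f A set0.
  by apply/andP; split; [apply/trivIsetP | apply/forallP] => B; rewrite inE.
have [P /maxsetP[packP maxP] _] := maxset_exists pack0; exists P => //.
rewrite -(cardsID (cover P) A) leq_add ?subset_leq_card ?subsetIr // mulnC.
apply: leq_trans (card_le_fibers (f := f) (d := 2) _) _ => [l|]; last first.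
  by rewrite leq_mul2r subset_leq_card // imsetS // subsetDl.
rewrite leqNgt; apply/negP => /card_gt2P[a [b [c [[]]]]].
rewrite !inE => /andP[/andP[aP aA] /eqP fa] /andP[/andP[bP bA] /eqP fb].
move=> /andP[/andP[cP cA] /eqP fc] [ab bc ca].
pose X := [set a; b; c].
have inX x : x \in X -> [/\ x \notin cover P, x \in A & f x = l].
  by rewrite !inE -orbA => /or3P[] /eqP->.
suff packXP : fiber_packing f A (X |: P).
  have XP : X \in P by rewrite -(maxP _ packXP) ?subsetUr // !inE eqxx.
  by case/bigcupP: aP; exists X; rewrite // !inE eqxx.
have /andP[/trivIsetP triv /forall_inP block] := packP.
have disjX B : B \in P -> [disjoint X & B].
  move=> BP; apply/pred0P => x /=; apply/negP => /andP[/inX[+ _ _] xB].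
  by move/negP; apply; apply/bigcupP; exists B.
apply/andP; split.
  apply/trivIsetP => B C; rewrite !in_setU1 => /predU1P[->|BP] /predU1P[->|CP] neq.
  - by rewrite eqxx in neq.
  - exact: disjX.
  - by rewrite disjoint_sym disjX.
  - exact: triv.
apply/forall_inP => B; rewrite in_setU1 => /predU1P[->|/block//].
rewrite cards3 ab bc eq_sym ca /=; apply/andP; split.
  by apply/subsetP => x /inX[].
by apply/forall_inP => x /inX[_ _ ->]; apply/forall_inP => y /inX[_ _ ->].
Qed.

Lemma link_fiber_packing P x y z :
  fiber_packing f A P -> (y, z) \in link P x -> link P x = [set (y, z); (z, y)].
Proof.
move=> packP xyz; apply/setP => -[y' z']; rewrite in_set2 !xpair_eqE.
have neq u v : (u, v) \in link P x -> [&& x != u, u != v & x != v].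
  by rewrite inE => /(fiber_packing_block packP)[_ /eqP]; rewrite cards3.
apply/idP/idP => [xyz'|]; last first.
  case/orP => /andP[/eqP-> /eqP->] //; by move: xyz; rewrite !inE /= setUAC.
have sameB : [set x; y; z] = [set x; y'; z'].
  move: xyz xyz'; rewrite !inE /= => yzP yzP'.
  by apply: (fiber_packing_inter (x := x) packP) => //; rewrite !inE eqxx.
have /and3P[xy' yz' xz'] := neq _ _ xyz'.
have : y' \in [set x; y; z] by rewrite sameB !inE eqxx ?orbT.
have : z' \in [set x; y; z] by rewrite sameB !inE eqxx ?orbT.
rewrite !inE ![_ == x]eq_sym (negbTE xy') (negbTE xz') /=.
by case/orP => /eqP ez /orP[] /eqP ey; move: yz'; rewrite ?ey ?ez !eqxx ?orbT.
Qed.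

Lemma card_link_fiber_packing P x :
  fiber_packing f A P -> #|link P x| = 2 * (x \in cover P).
Proof.
move=> packP; case: (boolP (x \in cover P)) => [/bigcupP[B BP xB]|xP]; last first.
  apply/eqP; rewrite muln0 cards_eq0 -subset0; apply/subsetP => -[y z]; rewrite !inE /= => BP.
  by case/negP: xP; apply/bigcupP; exists [set x; y; z]; rewrite // !inE eqxx.
have [_ B3 _] := fiber_packing_block packP BP.
have /cards2P[y [z [yz Bx]]] : #|B :\ x| == 2 by have := cardsD1 x B; rewrite B3 xB; lia.
rewrite (@link_fiber_packing _ x y z) //; last by rewrite inE /= -setUA -Bx setD1K.
by rewrite cards2 xpair_eqE (negbTE yz).
Qed.

End FiberPacking.

Section Directions.
Variables (T W L : finType) (lid : W -> T -> L) (V : {set W}) (A : {set T}).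
Hypothesis direction_inj : forall v w x y, v \in V -> w \in V -> x != y ->
  lid v x = lid v y -> lid w x = lid w y -> v = w.

Section Union.
Variable P : W -> {set {set T}}.
Hypothesis packP : forall v, fiber_packing (lid v) A (P v).
Let H := \bigcup_(v in V) P v.

Lemma linear_bigcup_packings : linear_triple_system A H.
Proof.
split=> [B /bigcupP[v _ BP]|B /bigcupP[v _ BP]|B C x y].
- by have [] := fiber_packing_block (packP v) BP.
- by have [] := fiber_packing_block (packP v) BP.
- move=> /bigcupP[v vV BP] /bigcupP[w wV CP] xy xB yB xC yC.
  have [_ _ constB] := fiber_packing_block (packP v) BP.
  have [_ _ constC] := fiber_packing_block (packP w) CP.
  have vw := direction_inj vV wV xy (constB _ _ xB yB) (constC _ _ xC yC).
  by rewrite -vw in CP; apply: fiber_packing_inter (packP v) BP CP xB xC.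
Qed.

Lemma card_link_bigcup_packings x : #|link H x| = \sum_(v in V) #|link (P v) x|.
Proof.
rewrite -card_bigcup_disjoint => [|v w [y z] vV wV].
  apply: eq_card => p; rewrite inE; apply/bigcupP/bigcupP => -[v vV pP]; exists v => //.
    by rewrite inE.
  by move: pP; rewrite inE.
rewrite !inE /= => vP wP; have [_ /eqP + constv] := fiber_packing_block (packP v) vP.
rewrite cards3 => /and3P[xy _ _]; have [_ _ constw] := fiber_packing_block (packP w) wP.
by apply: direction_inj vV wV xy (constv _ _ _ _) (constw _ _ _ _); rewrite !inE eqxx ?orbT.
Qed.

End Union.

Theorem exists_directed_triples (lam : nat) :
  (forall v, v \in V -> #|lid v @: A| <= lam) -> 4 * lam <= #|A| ->
  exists H, [/\ linear_triple_system A H, forall x, #|link H x| <= 2 * #|V|,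
    #|V| * #|A| <= \sum_x #|link H x| &
    forall B, B \in H -> exists2 v, v \in V & {in B &, forall x y, lid v x = lid v y}].
Proof.
move=> few_fibers large.
have /fin_all_exists2[P packP coverP] v := exists_fiber_packing (lid v) A.
exists (\bigcup_(v in V) P v); split; first exact: linear_bigcup_packings.
- move=> x; rewrite card_link_bigcup_packings // mulnC -sum_nat_const; apply: leq_sum => v _.
  by rewrite (card_link_fiber_packing _ (packP v)); case: (x \in _).
- under eq_bigr => x _ do rewrite card_link_bigcup_packings //.
  rewrite exchange_big /= -sum_nat_const; apply: leq_sum => v vV.
  under eq_bigr => x _ do rewrite (card_link_fiber_packing _ (packP v)) mulnC.
  by rewrite sum_mem_const; have := coverP v; have := few_fibers v vV; lia.
- move=> B /bigcupP[v vV BP]; exists v => //.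
  by have [] := fiber_packing_block (packP v) BP.
Qed.

End Directions.

(** * Lines of the grid *)

Definition grid (d n : nat) : finType := {ffun 'I_d -> 'I_n}.

Definition primitive (d n : nat) (v : grid d n) : bool :=
  [forall i, 0 < v i] && (\big[gcdn/0]_i v i == 1).

Definition height (d n : nat) (v x : grid d n) : nat :=
  \max_(h < n | [forall i, h * v i <= x i]) h.

Definition ord_sub (n : nat) (a : 'I_n) (m : nat) : 'I_n :=
  Ordinal (leq_ltn_trans (leq_subr m a) (ltn_ord a)).

(* The lowest grid point of the line through [x] in direction [v]. *)
Definition base (d n : nat) (v x : grid d n) : grid d n :=
  [ffun i => ord_sub (x i) (height v x * v i)].

Definition on_ray (d n : nat) (b v : grid d n) (k : nat) (x : grid d n) : Prop :=
  forall i, x i = b i + k * v i :> nat.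

Section Grid.
Variables d n : nat.
Implicit Types (v w x y b : grid d n) (i : 'I_d).

Lemma card_grid : #|grid d n| = n ^ d.
Proof. by rewrite card_ffun !card_ord. Qed.

Lemma grid_eq x y : (forall i, x i = y i :> nat) -> x = y.
Proof. by move=> eq_xy; apply/ffunP => i; apply: val_inj; apply: eq_xy. Qed.

Lemma primitive_gt0 v i : primitive v -> 0 < v i.
Proof. by case/andP=> /forallP. Qed.

Lemma primitive_dim_gt0 v : primitive v -> 0 < d.
Proof.
case/andP=> _ /eqP gcd_v; case: (pickP 'I_d) => [i _|none].
  exact: leq_ltn_trans (leq0n i) (ltn_ord i).
by move: gcd_v; rewrite big_pred0.
Qed.

Lemma leq_height v x h :
  primitive v -> (h <= height v x) = [forall i, h * v i <= x i].
Proof.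
move=> prim; apply/idP/forallP => [le_h i|le_x].
  suff /forallP/(_ i) : [forall i, height v x * v i <= x i].
    by apply: leq_trans; rewrite leq_mul2r le_h orbT.
  rewrite /height; elim/big_ind: _ => [|a c /forallP le_a /forallP le_c|j //].
    by apply/forallP.
  by apply/forallP => j; rewrite /maxn; case: ifP.
pose i0 := Ordinal (primitive_dim_gt0 prim).
have lt_hn : h < n.
  apply: leq_ltn_trans (ltn_ord (x i0)); apply: leq_trans (le_x i0).
  by rewrite leq_pmulr ?primitive_gt0.
by rewrite /height (leq_bigmax_cond (Ordinal lt_hn)) //; apply/forallP.
Qed.

Lemma height_mul_le v x i : primitive v -> height v x * v i <= x i.
Proof. by move/leq_height => /(_ x (height v x)); rewrite leqnn => /esym/forallP. Qed.

Lemma on_ray_base v x : primitive v -> on_ray (base v x) v (height v x) x.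
Proof. by move=> prim i; rewrite ffunE /= subnK // height_mul_le. Qed.

Lemma height_on_ray b v k x : primitive v -> on_ray b v k x -> height v x = k + height v b.
Proof.
move=> prim ray; apply/eqP; rewrite eqn_leq -leq_subLR !leq_height //.
apply/andP; split; apply/forallP => i; have := height_mul_le _ i prim.
  by move=> /(_ x); rewrite mulnBl leq_subLR [k * _ + _]addnC -ray.
by move=> /(_ b); rewrite ray mulnDl addnC leq_add2r.
Qed.

Lemma on_ray_base_eq b v k x : primitive v -> on_ray b v k x -> base v x = base v b.
Proof.
move=> prim ray; apply: grid_eq => i; rewrite !ffunE /= (height_on_ray prim ray) ray.
by rewrite mulnDl addnC subnDl.
Qed.

Lemma on_ray_height_sub v x y : primitive v -> base v x = base v y ->
  height v x <= height v y -> on_ray x v (height v y - height v x) y.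
Proof.
move=> prim eq_base le_xy i; have := on_ray_base x prim i; have := on_ray_base y prim i.
by rewrite -eq_base mulnBl => -> ->; rewrite -addnA subnKC // leq_mul2r le_xy orbT.
Qed.

Lemma height_base_inj v x y :
  primitive v -> base v x = base v y -> height v x = height v y -> x = y.
Proof.
move=> prim eq_base eq_height; apply: grid_eq => i.
by rewrite (on_ray_base x prim) (on_ray_base y prim) eq_base eq_height.
Qed.

Lemma primitive_mul_inj v w k l : 0 < k -> primitive v -> primitive w ->
  (forall i, k * v i = l * w i) -> v = w.
Proof.
move=> k_gt0 /andP[_ /eqP gcd_v] /andP[_ /eqP gcd_w] eq_kl.
have eq_k : k = l.
  rewrite -[k]muln1 -[l]muln1 -{1}gcd_v -gcd_w.
  rewrite !(big_morph _ (muln_gcdr _) (muln0 _)).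
  by apply: eq_bigr => i _; apply: eq_kl.
by apply: grid_eq => i; apply/eqP; rewrite -(eqn_pmul2l k_gt0) {2}eq_k eq_kl.
Qed.

Lemma direction_unique v w x y : primitive v -> primitive w -> x != y ->
  base v x = base v y -> base w x = base w y -> v = w.
Proof.
move=> prim_v prim_w.
wlog le_v : x y / height v x <= height v y => [sym neq base_v base_w|neq base_v base_w].
  case: (leqP (height v x) (height v y)) => [le|/ltnW le]; first exact: (sym x y).
  by apply: (sym y x); rewrite // eq_sym.
have ray_v := on_ray_height_sub prim_v base_v le_v.
have lt_v : height v x < height v y.
  rewrite ltn_neqAle le_v andbT; apply: contra neq => /eqP eq_height.
  by rewrite (height_base_inj prim_v base_v eq_height).
have le_w : height w x <= height w y.
  rewrite leqNgt; apply/negP => /ltnW /(on_ray_height_sub prim_w (esym base_w)) ray_w.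
  pose i := Ordinal (primitive_dim_gt0 prim_v); have := primitive_gt0 i prim_v.
  by have := ray_v i; have := ray_w i; nia.
have ray_w := on_ray_height_sub prim_w base_w le_w.
apply: (@primitive_mul_inj _ _ (height v y - height v x) (height w y - height w x)) => //.
  by rewrite subn_gt0.
by move=> i; have := ray_v i; rewrite ray_w => /addnI.
Qed.

Lemma primitive_multiple v (c : 'I_d -> nat) : primitive v ->
  (forall i j, c i * v j = c j * v i) -> exists t, forall i, c i = t * v i.
Proof.
move=> prim prop; have /andP[_ /eqP gcd_v] := prim.
pose i0 := Ordinal (primitive_dim_gt0 prim).
have /dvdnP[t ct] : v i0 %| c i0.
  rewrite -[c i0]muln1 -gcd_v (big_morph _ (muln_gcdr _) (muln0 _)).
  by elim/big_ind: _ => // [a b va vb|j _]; rewrite ?dvdn_gcd ?va // prop dvdn_mull.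
exists t => i; apply/eqP; rewrite -(eqn_pmul2r (primitive_gt0 i0 prim)).
by rewrite prop ct mulnAC.
Qed.

Definition zcoords (x : grid d n) (a : nat) : Z :=
  if insub a is Some i then Z.of_nat (x i) else 0%Z.

Lemma zcoords_ord x i : zcoords x i = Z.of_nat (x i).
Proof. by rewrite /zcoords valK. Qed.

Lemma base_collinear v x y z : primitive v ->
  base v x = base v y -> base v y = base v z ->
  collinear d (zcoords x) (zcoords y) (zcoords z).
Proof.
move=> prim base_xy base_yz a b /ltP ad /ltP bd.
rewrite -[a]/(val (Ordinal ad)) -[b]/(val (Ordinal bd)) !zcoords_ord.
have := on_ray_base x prim; have := on_ray_base y prim; have := on_ray_base z prim.
rewrite -base_yz -base_xy => ray_z ray_y ray_x.
by rewrite !ray_x !ray_y !ray_z; lia.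
Qed.

Lemma proportional_base v x w : primitive v ->
  (forall i j, (Z.of_nat (v i) * (Z.of_nat (w j) - Z.of_nat (x j)) =
                Z.of_nat (v j) * (Z.of_nat (w i) - Z.of_nat (x i)))%Z) ->
  base v w = base v x.
Proof.
move=> prim prop; pose i0 := Ordinal (primitive_dim_gt0 prim).
wlog le_x : x w prop / x i0 <= w i0 => [sym|].
  case: (leqP (x i0) (w i0)) => [|/ltnW] le; first exact: sym le.
  by symmetry; apply: sym le => i j; have := prop i j; lia.
have le_xw i : x i <= w i.
  by have := prop i0 i; have := primitive_gt0 i prim; have := primitive_gt0 i0 prim; nia.
have [|t ray] := @primitive_multiple v (fun i => w i - x i) prim.
  by move=> i j; have := prop i j; have := le_xw i; have := le_xw j; nia.
by apply: (on_ray_base_eq (k := t) prim) => i; rewrite -ray subnKC.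
Qed.

Lemma collinear_base v x y w : primitive v -> x != y -> base v x = base v y ->
  collinear d (zcoords x) (zcoords y) (zcoords w) -> base v w = base v x.
Proof.
move=> prim neq base_xy col; apply: proportional_base => // i j.
have := col _ _ (elimT ltP (ltn_ord i)) (elimT ltP (ltn_ord j)); rewrite !zcoords_ord.
have := on_ray_base x prim; have := on_ray_base y prim.
rewrite -base_xy => ray_y ray_x; rewrite !ray_y => minor.
have neq_height : height v x <> height v y.
  by move=> eq_height; rewrite (height_base_inj prim base_xy eq_height) eqxx in neq.
apply: (Z.mul_reg_l _ _ (Z.of_nat (height v y) - Z.of_nat (height v x))%Z); first by lia.
by have := ray_x i; have := ray_x j; nia.
Qed.

End Grid.

(** * Counting directions and lines *)

Lemma leq_card_ord (n m : nat) (X : {set 'I_n}) (g : nat -> nat) :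
  {in X &, forall i j : 'I_n, g i = g j -> i = j} -> (forall i, i \in X -> g i < m) ->
  #|X| <= m.
Proof.
move=> inj lt_m; rewrite cardE -(size_map (fun i : 'I_n => g i)) -(size_iota 0 m).
apply: uniq_leq_size => [|x /mapP[i]].
  by rewrite map_inj_in_uniq ?enum_uniq // => i j; rewrite !mem_enum; apply: inj.
by rewrite mem_enum mem_iota => /lt_m lt_i ->.
Qed.

Lemma card_ord_lt (n k : nat) : #|[set a : 'I_n | a < k]| <= k.
Proof. by apply: (@leq_card_ord _ _ _ id) => [i j _ _ /val_inj|i]; rewrite ?inE. Qed.

Lemma card_ord_multiples (n k c : nat) : 0 < c ->
  #|[set a : 'I_n | [&& 0 < a, a <= k & c %| a]]| <= k %/ c.
Proof.
move=> c_gt0; apply: (@leq_card_ord _ _ _ (fun a => (a %/ c).-1)) => [a b|a].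
  rewrite !inE => /and3P[a_gt0 _ /dvdnP[s a_eq]] /and3P[b_gt0 _ /dvdnP[t b_eq]].
  move=> eq_quot; apply: val_inj; move: a_gt0 b_gt0 eq_quot.
  rewrite /= a_eq b_eq !mulnK // !muln_gt0 => /andP[s_gt0 _] /andP[t_gt0 _] eq_quot.
  by have -> : s = t by lia.
rewrite inE => /and3P[+ + /dvdnP[s a_eq]].
by rewrite a_eq mulnK // muln_gt0 -leq_divRL // => /andP[s_gt0 _]; lia.
Qed.

Lemma leq_card_ord_pos (n k : nat) : k < n -> k <= #|[set a : 'I_n | 0 < a <= k]|.
Proof.
move=> kn; rewrite cardE -(size_map val) -{1}(size_iota 1 k).
apply: uniq_leq_size (iota_uniq _ _) _ => a; rewrite mem_iota => a_range.
have an : a < n by lia.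
by apply/mapP; exists (Ordinal an); rewrite // mem_enum inE /=; lia.
Qed.

Lemma card_maps_into (T I : finType) (S : {set I}) (C : {set T}) :
  #|[set f : {ffun I -> T} | f @: S \subset C]| = #|C| ^ #|S| * #|T| ^ #|~: S|.
Proof.
pose F i : {set T} := if i \in S then C else setT.
have -> : #|[set f : {ffun I -> T} | f @: S \subset C]| = #|family F|.
  apply: eq_card => f; rewrite inE; apply/subsetP/familyP => [fS i|fF _ /imsetP[i iS ->]].
    by rewrite /F; case: ifP => iS; rewrite ?in_setT ?fS ?imset_f.
  by have := fF i; rewrite /F iS.
rewrite card_family foldrE big_map big_enum /= (bigID (mem S)) /=.
rewrite (eq_bigr (fun=> #|C|)) => [|i iS]; last by rewrite /F iS.
rewrite [X in _ * X](eq_bigr (fun=> #|T|)) => [|i /negbTE iS]; last by rewrite /F iS cardsT.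
rewrite !prod_nat_const; congr (_ * _ ^ _).
by apply: eq_card => i; rewrite !inE.
Qed.

Definition small_directions (d n k : nat) : {set grid d n} :=
  [set v | primitive v & [forall i, v i <= k]].

(* The lowest point of a line has a coordinate smaller than the corresponding
   coordinate of the direction. *)
Lemma card_lines (d n k : nat) (A : {set grid d n}) (v : grid d n) :
  v \in small_directions d n k -> #|base v @: A| <= d * (k * n ^ d.-1).
Proof.
rewrite inE => /andP[prim /forallP v_le].
pose low i := [set x : grid d n | x @: [set i] \subset [set a : 'I_n | a < k]].
apply: leq_trans (_ : #|\bigcup_(i in 'I_d) low i| <= _).
  apply: subset_leq_card; apply/subsetP => _ /imsetP[x _ ->].
  have : ~~ ((height v x).+1 <= height v x) by rewrite ltnn.
  rewrite leq_height // negb_forall => /existsP[i]; rewrite -ltnNge mulSn => lt_v.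
  apply/bigcupP; exists i => //; rewrite inE imset_set1 sub1set inE ffunE /=.
  by apply: leq_trans (v_le i); rewrite ltn_subLR ?height_mul_le // addnC.
apply: leq_trans (leq_card_bigcup _ _) _; rewrite -[X in X * _](card_ord d) -sum_nat_const.
apply: leq_sum => i _; rewrite card_maps_into cards1 expn1 card_ord cardsC1 card_ord.
by rewrite leq_mul2r card_ord_lt orbT.
Qed.

Lemma sum_cubes_div (k m : nat) :
  2 * m.+1 * (\sum_(2 <= c < m.+2) (k %/ c) ^ 3) <= k ^ 3 * m.
Proof.
elim: m => [|m IH]; first by rewrite big_geq.
rewrite big_nat_recr //=; set S := \sum_(_ <= _ < _) _ in IH *.
set y := k %/ m.+2; have y_le : (y * m.+2) ^ 3 <= k ^ 3 by rewrite leq_exp2r ?leq_divM.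
rewrite -(leq_pmul2l (ltn0Sn m)).
have IHm : m.+2 * (2 * m.+1 * S) <= m.+2 * (k ^ 3 * m) by rewrite leq_mul2l IH orbT.
have term_le : 2 * m.+1 * m.+2 * y ^ 3 <= k ^ 3.
  apply: leq_trans y_le; rewrite expnMn mulnC leq_mul2l; apply/orP; right.
  by rewrite !expnS expn0; nia.
by nia.
Qed.

Lemma sum_powers_div (d k m : nat) : 2 < d -> 2 * (\sum_(2 <= c < m) (k %/ c) ^ d) <= k ^ d.
Proof.
move=> d_gt2; rewrite -(subnKC d_gt2) expnD.
have cubes : 2 * (\sum_(2 <= c < m) (k %/ c) ^ 3) <= k ^ 3.
  case: m => [|[|m]]; [by rewrite big_geq | by rewrite big_geq |].
  rewrite -(leq_pmul2l (ltn0Sn m)); move: (sum_cubes_div k m).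
  by move: (k ^ 3) (\sum_(_ <= _ < _) _) => K S; lia.
apply: leq_trans (leq_mul cubes (leqnn _)); rewrite -mulnA leq_mul2l big_distrl /=.
by apply: leq_sum => c _; rewrite expnD leq_mul2l leq_wexp2r ?leq_div ?orbT.
Qed.

Lemma card_small_directions (d n k : nat) :
  2 < d -> k < n -> k ^ d <= 2 * #|small_directions d n k|.
Proof.
move=> d_gt2 kn; have d_gt0 : 0 < d by lia.
pose X c := [set a : 'I_n | [&& 0 < a, a <= k & c %| a]].
pose B c : {set grid d n} := [set v in ffun_on (X c)].
have cardB c : #|B c| = #|X c| ^ d by rewrite cardsE card_ffun_on card_ord.
have cover : B 1 \subset small_directions d n k :|: \bigcup_(c < k.+1 | 1 < c) B c.
  apply/subsetP => v; rewrite [v \in B 1]inE => /ffun_onP vX.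
  have range i : 0 < v i <= k by have := vX i; rewrite !inE dvd1n andbT.
  rewrite in_setU inE /primitive; set g := \big[gcdn/0]_i v i.
  have -> : [forall i, 0 < v i] by apply/forallP => i; case/andP: (range i).
  have -> : [forall i, v i <= k] by apply/forallP => i; case/andP: (range i).
  have g_dvd i : g %| v i by rewrite /g (bigD1 i) //= dvdn_gcdl.
  pose i0 := Ordinal d_gt0; have /andP[v0_gt0 v0_le] := range i0.
  have g_gt0 : 0 < g by apply: dvdn_gt0 (g_dvd i0).
  have gk : g < k.+1 by rewrite ltnS (leq_trans (dvdn_leq v0_gt0 (g_dvd i0))).
  rewrite andbT; case: eqP => //= g_neq1.
  apply/bigcupP; exists (Ordinal gk) => /=; first by lia.
  rewrite inE; apply/ffun_onP => i; rewrite inE g_dvd andbT; exact: range.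
have card_split : k ^ d <= #|small_directions d n k| + \sum_(2 <= c < k.+1) (k %/ c) ^ d.
  apply: (@leq_trans #|B 1|).
    rewrite cardB leq_exp2r // (leq_trans (leq_card_ord_pos kn)) //.
    by apply: eq_leq; apply: eq_card => a; rewrite !inE dvd1n andbT.
  apply: leq_trans (subset_leq_card cover) _.
  apply: leq_trans (leq_card_setU _ _) _; rewrite leq_add2l big_geq_mkord /=.
  apply: leq_trans (leq_card_bigcup _ _) _; apply: leq_sum => c c_gt1.
  by rewrite cardB leq_exp2r // card_ord_multiples //; lia.
by have := sum_powers_div k k.+1 d_gt2; lia.
Qed.

(** * Containers for line-free sets *)

Definition line_free (d n : nat) (I : {set grid d n}) : bool :=
  [forall v, primitive v ==> [forall b, #|[set x in I | base v x == b]| <= 2]].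

Lemma line_free_containers (d n k D t : nat) (A : {set grid d n}) :
  2 < d -> k < n -> 0 < D -> D <= k ^ d -> 4 * (d * (k * n ^ d.-1)) <= #|A| ->
  8 * #|A| * D <= k ^ d * t -> 24 * #|A| <= D * t ->
  exists F : {set {set grid d n}}, [/\ #|F| <= (n ^ d).+1 ^ (2 * t),
    forall C, C \in F -> 48 * #|C| <= 47 * #|A| & covers (@line_free d n) A F].
Proof.
move=> d_gt2 kn D_gt0 D_le large room_pairs room_nbrs.
have card_V := card_small_directions d_gt2 kn; set V := small_directions d n k in card_V.
have dirV v : v \in V -> primitive v by rewrite inE => /andP[].
have [H [linH link_le link_mean blocks]] : exists H, [/\ linear_triple_system A H,
    forall x, #|link H x| <= 2 * #|V|, #|V| * #|A| <= \sum_x #|link H x| &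
    forall B, B \in H -> exists2 v, v \in V & {in B &, forall x y, base v x = base v y}].
  apply: exists_directed_triples large => [v w x y /dirV pv /dirV pw|v].
    exact: direction_unique.
  exact: card_lines.
have [|F [card_F shrink cover]] := linear_system_containers linH link_le link_mean D_gt0
  (leq_trans D_le card_V) (t := t) _ room_nbrs.
  by nia.
exists F; split=> //; first by rewrite -[n ^ d]card_grid.
move=> I IA /forallP freeI; apply: cover => // B BH; apply/negP => /subsetP BI.
have [v /dirV prim constB] := blocks _ BH; have B3 := triple_card linH BH.
have [x xB] : exists x, x \in B by apply/card_gt0P; rewrite B3.
have /implyP/(_ prim)/forallP/(_ (base v x)) := freeI v; rewrite leqNgt -B3 subset_leq_card //.
by apply/subsetP => y yB; rewrite inE BI // (constB y x) ?eqxx.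
Qed.

(* The cut-off [k] on directions is proportional to the density of [A]. *)
Lemma exists_container_parameters (q a : nat) : 0 < q -> 12 * q ^ 8 <= a -> a <= q ^ 9 ->
  exists k, [/\ k < q ^ 3, 0 < q * k <= k ^ 3, 4 * (3 * (k * (q ^ 3) ^ 2)) <= a,
    8 * a * (q * k) <= k ^ 3 * (576 * q ^ 5) & 24 * a <= q * k * (576 * q ^ 5)].
Proof.
move=> q_gt0 a_ge a_le; pose k := a %/ (12 * q ^ 6); exists k.
have q6_gt0 : 0 < q ^ 6 by rewrite expn_gt0 q_gt0.
have q8_eq : q ^ 8 = q ^ 6 * q ^ 2 by rewrite -expnD.
have q9_eq : q ^ 9 = q ^ 6 * q ^ 3 by rewrite -expnD.
have q6_eq : q ^ 6 = q ^ 5 * q by rewrite -expnSr.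
have q2_eq : q ^ 2 = q * q by rewrite expnS expn1.
have k3_eq : k ^ 3 = k * (k * k) by rewrite !expnS expn0 muln1.
have k_ge : q ^ 2 <= k by rewrite leq_divRL; nia.
have ka : 12 * q ^ 6 * k <= a by rewrite mulnC leq_divM.
have k_gt0 : 0 < k by nia.
have ak : a <= 24 * (q ^ 6 * k).
  have : a < k.+1 * (12 * q ^ 6) by rewrite ltn_ceil; lia.
  by nia.
split.
- by move: q9_eq a_le ka; move: (q ^ 9) (q ^ 6) (q ^ 3) q6_gt0 => x y z; nia.
- by rewrite muln_gt0 q_gt0 k_gt0 k3_eq /=; nia.
- by rewrite -expnM; lia.
- have : q * k * a <= q * k * (24 * (q ^ 6 * k)) by rewrite leq_mul2l ak orbT.
  have : q ^ 5 * k * k * q ^ 2 <= q ^ 5 * k * k * k by rewrite leq_mul2l k_ge orbT.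
  by rewrite q6_eq k3_eq q2_eq; move: (q ^ 5) => p; lia.
- by rewrite q6_eq in ak; move: (q ^ 5) ak => p; lia.
Qed.

(* Number of pairs of fingerprints of length at most [576 * q ^ 5]. *)
Definition fingerprint_count (q : nat) : nat := (q ^ 9).+1 ^ (2 * (576 * q ^ 5)).

Lemma bernoulli_nat (m j : nat) : m ^ j * (m + j) <= m * m.+1 ^ j.
Proof.
elim: j => [|j IH]; first by rewrite !expn0; lia.
by rewrite !expnS; move: (m ^ j) (m.+1 ^ j) IH => a b; nia.
Qed.

Lemma doubling_pow (m l : nat) : 0 < m -> 2 ^ l * m ^ (m * l) <= m.+1 ^ (m * l).
Proof.
move=> m_gt0; rewrite !(expnM _ m) -expnMn leq_wexp2r // -(leq_pmul2l m_gt0).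
by apply: leq_trans (bernoulli_nat m m); move: (m ^ m) => a; lia.
Qed.

Theorem grid_containers (q l : nat) : 0 < q -> q <= 2 ^ l ->
  exists F : {set {set grid 3 (q ^ 3)}}, [/\ #|F| <= fingerprint_count q ^ (47 * l),
    forall C, C \in F -> #|C| <= 12 * q ^ 8 & covers (@line_free 3 (q ^ 3)) setT F].
Proof.
move=> q_gt0 ql; apply: (@iterated_containers _ _ 47 48) => //.
- by rewrite expn_gt0.
- move=> A /ltnW large.
  have [|k [kn /andP[D_gt0 D_le] few room_pairs room_nbrs]] :=
    exists_container_parameters q_gt0 large.
    by rewrite (leq_trans (max_card _)) // card_grid -expnM.
  rewrite /fingerprint_count (expnM q 3 3).
  exact: line_free_containers kn D_gt0 D_le few room_pairs room_nbrs.
- rewrite cardsT card_grid -expnM expnS; have := @doubling_pow 47 l isT.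
  move: (q ^ 8) (47 ^ (47 * l)) (48 ^ (47 * l)) => p a b doubling.
  have : q * a * p <= 2 ^ l * a * p by rewrite !leq_mul2r ql !orbT.
  have : 2 ^ l * a * p <= b * p by rewrite leq_mul2r doubling orbT.
  by move: (2 ^ l * a * p) => c; nia.
Qed.

(** * Random selection of points *)

Definition restrict (T J I : finType) (f : {ffun I -> T}) (g : {ffun J -> I}) :
  {ffun J -> T} := [ffun j => f (g j)].

Lemma restrictE (T J I : finType) (f : {ffun I -> T}) (g : {ffun J -> I}) j :
  restrict f g j = f (g j).
Proof. by rewrite ffunE. Qed.

Lemma card_restrict (T J I : finType) (g : {ffun J -> I}) (W : {set {ffun J -> T}}) :
  injective g ->
  #|[set f : {ffun I -> T} | restrict f g \in W]| * #|T| ^ #|J| <= #|W| * #|T| ^ #|I|.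
Proof.
move=> inj; pose U : finType := {i : I | i \notin codom g}.
pose split (f : {ffun I -> T}) : {ffun J -> T} * {ffun U -> T} :=
  (restrict f g, [ffun u => f (val u)]).
have split_inj : injective split.
  move=> f f' [/ffunP eq_g /ffunP eq_U]; apply/ffunP => i.
  case: (boolP (i \in codom g)) => [/codomP[j ->]|notg].
    by have := eq_g j; rewrite !ffunE.
  by have := eq_U (Sub i notg); rewrite !ffunE.
have card_U : #|U| + #|J| = #|I|.
  by rewrite card_sig addnC -(card_codom inj) cardC.
rewrite -card_U expnD mulnA leq_mul2r; apply/orP; right.
rewrite -card_ffun -[#|{: {ffun U -> T}}|]cardsT -cardsX -(card_imset _ split_inj).
apply: subset_leq_card; apply/subsetP => _ /imsetP[f + ->].
by rewrite in_set in_setX in_setT andbT.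
Qed.

Lemma sum_card_exchange (T U : finType) (P : pred U) (R : T -> U -> bool) :
  \sum_x #|[set y | P y & R x y]| = \sum_(y | P y) #|[set x | R x y]|.
Proof.
under eq_bigr => x _ do rewrite -sum1_card big_mkcond /=.
rewrite exchange_big /= [RHS]big_mkcond /=; apply: eq_bigr => y _.
rewrite -[in RHS]sum1_card [in RHS]big_mkcond; case: ifP => Py.
  by apply: eq_bigr => x _; rewrite !inE Py.
by apply: big1 => x _; rewrite inE Py.
Qed.

Definition hits (T J I : finType) (W : {set {ffun J -> T}}) (f : {ffun I -> T}) :
  {set {ffun J -> I}} := [set g : {ffun J -> I} | injectiveb g & restrict f g \in W].

Lemma sum_card_hits (T J I : finType) (W : {set {ffun J -> T}}) (c : nat) :
  0 < #|J| -> 0 < #|T| -> c * #|I| ^ #|J|.-1 * #|W| <= #|T| ^ #|J| ->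
  c * (\sum_(f : {ffun I -> T}) #|hits W f|) <= #|I| * #|T| ^ #|I|.
Proof.
move=> J_gt0 T_gt0 sparse; have TJ_gt0 : 0 < #|T| ^ #|J| by rewrite expn_gt0 T_gt0.
have total : (\sum_(f : {ffun I -> T}) #|hits W f|) * #|T| ^ #|J| <=
    #|I| ^ #|J| * (#|W| * #|T| ^ #|I|).
  rewrite sum_card_exchange big_distrl /= -[#|I| ^ #|J|]card_ffun.
  apply: (@leq_trans (\sum_(g : {ffun J -> I} | injectiveb g) (#|W| * #|T| ^ #|I|))).
    by apply: leq_sum => g /injectiveP; apply: card_restrict.
  by rewrite sum_nat_const leq_mul2r max_card orbT.
rewrite -(leq_pmul2r TJ_gt0) -mulnA (leq_trans (leq_mul (leqnn c) total)) //.
have -> : #|I| ^ #|J| = #|I| * #|I| ^ #|J|.-1 by rewrite -expnS prednK.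
have := leq_mul (leqnn (#|I| * #|T| ^ #|I|)) sparse; move: (_ ^ _.-1) (_ ^ #|J|) (_ ^ #|I|).
by move=> a b e; lia.
Qed.

Definition captured (T I : finType) (m : nat) (F : {set {set T}}) (f : {ffun I -> T}) :
  {set {set I}} := [set S : {set I} | #|S| == m & [exists C in F, f @: S \subset C]].

Lemma sum_card_captured (T I : finType) (m n : nat) (F : {set {set T}}) :
  (forall C, C \in F -> #|C| <= n) ->
  (\sum_(f : {ffun I -> T}) #|captured m F f|) * #|T| ^ m <=
  'C(#|I|, m) * (#|F| * n ^ m) * #|T| ^ #|I|.
Proof.
move=> small; rewrite sum_card_exchange -mulnA -card_draws big_distrl /=.
rewrite (eq_bigl (fun S => S \in [set S : {set I} | #|S| == m])) => [|S]; last by rewrite inE.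
rewrite -sum_nat_const; apply: leq_sum => S; rewrite inE => /eqP card_S.
have cover : [set f : {ffun I -> T} | [exists C in F, f @: S \subset C]] \subset
    \bigcup_(C in F) [set f : {ffun I -> T} | f @: S \subset C].
  apply/subsetP => f; rewrite inE => /existsP[C /andP[CF SC]].
  by apply/bigcupP; exists C; rewrite // inE.
have := leq_trans (subset_leq_card cover) (leq_card_bigcup _ _).
move=> /leq_mul/(_ (leqnn (#|T| ^ m)))/leq_trans; apply.
rewrite big_distrl /= -mulnA -sum_nat_const; apply: leq_sum => C CF.
rewrite -card_S card_maps_into -mulnA -expnD [_ + #|S|]addnC cardsC.
by rewrite leq_mul2r leq_wexp2r ?orbT ?small.
Qed.

Lemma exists_lt_mean (T : finType) (f : T -> nat) (c : nat) :
  \sum_x f x < #|T| * c -> exists x, f x < c.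
Proof.
move=> lt_sum; apply/existsP; apply: contraLR lt_sum.
rewrite negb_exists -leqNgt => /forallP ge_c.
by rewrite -sum_nat_const; apply: leq_sum => x _; rewrite leqNgt.
Qed.

Lemma delete_hits (T J I : finType) (j0 : J) (W : {set {ffun J -> T}}) (f : {ffun I -> T}) :
  exists2 R : {set I}, #|I| <= #|R| + #|hits W f| &
    forall g : {ffun J -> I}, injective g -> (forall j, g j \in R) -> restrict f g \notin W.
Proof.
pose hit := [set g j0 | g : {ffun J -> I} in hits W f]; exists (~: hit).
  by rewrite addnC -(cardsC hit) leq_add2r leq_imset_card.
move=> g inj gR; have := gR j0; rewrite inE; apply: contra => gW.
by apply/imsetP; exists g; rewrite // inE gW andbT; apply/injectiveP.
Qed.

Definition coincident (T : finType) : {set {ffun bool -> T}} :=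
  [set h : {ffun bool -> T} | h false == h true].

Lemma card_coincident (T : finType) : #|coincident T| <= #|T|.
Proof.
have inj : {in coincident T &, injective (fun h : {ffun bool -> T} => h false)}.
  move=> h h'; rewrite !inE => /eqP ht /eqP ht' eq_f; apply/ffunP => -[] //.
  by rewrite -ht -ht'.
by rewrite -(card_in_imset inj) max_card.
Qed.

Lemma inj_avoid_coincident (T I : finType) (f : {ffun I -> T}) (R : {set I}) :
  (forall g : {ffun bool -> I}, injective g -> (forall b, g b \in R) ->
     restrict f g \notin coincident T) -> {in R &, injective f}.
Proof.
move=> avoid i j iR jR eq_f; apply/eqP; apply: contraT => neq.
pose g : {ffun bool -> I} := [ffun b => if b then j else i].
have /avoid : injective g.
  by move=> [] []; rewrite !ffunE // => e; rewrite e eqxx in neq.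
by rewrite inE !ffunE eq_f eqxx; apply=> -[]; rewrite ffunE.
Qed.

Lemma subset_of_size (T : finType) (A : {set T}) (m : nat) :
  m <= #|A| -> exists2 B : {set T}, B \subset A & #|B| = m.
Proof.
case/card_geqP => s [uniq_s size_s sA]; exists [set x in s].
  by apply/subsetP => x; rewrite inE => /sA.
by rewrite cardsE (card_uniqP uniq_s).
Qed.

Lemma exists_sparse_sample (T J I : finType) (m n : nat) (Bad : {set {ffun J -> T}})
    (F : {set {set T}}) :
  0 < #|I| -> 0 < #|J| -> 16 * #|I| ^ #|J|.-1 * #|Bad| <= #|T| ^ #|J| -> 16 * #|I| <= #|T| ->
  (forall C, C \in F -> #|C| <= n) ->
  4 * ('C(#|I|, m) * (#|F| * n ^ m)) <= #|T| ^ m ->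
  exists f : {ffun I -> T}, captured m F f = set0 /\
    2 * (#|hits Bad f| + #|hits (coincident T) f|) <= #|I|.
Proof.
move=> I_gt0 J_gt0 sparse large small few; have T_gt0 : 0 < #|T| by lia.
have sum_bad := sum_card_hits J_gt0 T_gt0 sparse.
have sum_coincident : 16 * (\sum_(f : {ffun I -> T}) #|hits (coincident T) f|) <=
    #|I| * #|T| ^ #|I|.
  apply: sum_card_hits; rewrite ?card_bool // expn1.
  by apply: leq_trans (leq_mul large (card_coincident T)) _; rewrite mulnn.
have sum_captured : 4 * (\sum_(f : {ffun I -> T}) #|captured m F f|) <= #|T| ^ #|I|.
  have Tm_gt0 : 0 < #|T| ^ m by rewrite expn_gt0 T_gt0.
  rewrite -(leq_pmul2r Tm_gt0) -mulnA.
  apply: leq_trans (leq_mul (leqnn 4) (sum_card_captured _ _ small)) _.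
  by rewrite mulnA [leqRHS]mulnC leq_mul2r few orbT.
have [|f lt_mean] := @exists_lt_mean {ffun I -> T} (fun f => 16 * #|hits Bad f| +
    16 * #|hits (coincident T) f| + 4 * #|I| * #|captured m F f|) (4 * #|I|).
  rewrite 2!big_split -!big_distrr card_ffun.
  have T_pow : 0 < #|T| ^ #|I| by rewrite expn_gt0 T_gt0.
  move: sum_bad sum_coincident sum_captured; move: (#|T| ^ _) T_pow => M M_gt0.
  set x := \sum_f #|hits Bad f|; set y := \sum_f #|hits _ f|; set z := \sum_f _.
  move=> le_x le_y le_z; clearbody x y z.
  change (16 * x + 16 * y + 4 * #|I| * z < M * (4 * #|I|)).
  have := leq_mul (leqnn #|I|) le_z; have : 0 < #|I| * M by rewrite muln_gt0 I_gt0.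
  by lia.
by exists f; split; [apply: cards0_eq; nia | nia].
Qed.

Theorem random_selection (T J : finType) (j0 : J) (N m n : nat) (Bad : {set {ffun J -> T}})
    (F : {set {set T}}) :
  0 < N -> 16 * (2 * N) ^ #|J|.-1 * #|Bad| <= #|T| ^ #|J| -> 32 * N <= #|T| ->
  (forall C, C \in F -> #|C| <= n) ->
  4 * ('C(2 * N, m) * (#|F| * n ^ m)) <= #|T| ^ m ->
  exists h : {ffun 'I_N -> T}, [/\ injective h,
    forall g : {ffun J -> 'I_N}, injective g -> restrict h g \notin Bad &
    forall S : {set 'I_N}, m <= #|S| -> forall C, C \in F -> ~~ (h @: S \subset C)].
Proof.
move=> N_gt0 sparse large small few.
have J_gt0 : 0 < #|J| by apply/card_gt0P; exists j0.
have := @exists_sparse_sample T J 'I_(2 * N) m n Bad F; rewrite card_ord.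
case=> [|//|//||//|//|f [no_captured few_hits]]; [by lia | by lia |].
have [R card_R avoidR] := delete_hits j0 Bad f.
have [R' card_R' avoidR'] := delete_hits true (coincident T) f.
have NR : N <= #|R :&: R'|.
  have cardU : #|R :|: R'| <= 2 * N by rewrite -[leqRHS]card_ord max_card.
  by rewrite !card_ord in card_R card_R'; have := cardsUI R R'; lia.
pose e (i : 'I_N) : 'I_(2 * N) := enum_val (widen_ord NR i).
have eR i : e i \in R :&: R' by apply: enum_valP.
have e_inj : injective e by move=> i j /enum_val_inj /(congr1 val) /= /val_inj.
have f_inj := inj_avoid_coincident avoidR'.
exists [ffun i => f (e i)]; split.
- move=> i j; rewrite !ffunE => /f_inj eq_e; apply: e_inj; apply: eq_e.
    by case/setIP: (eR i).
  by case/setIP: (eR j).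
- move=> g g_inj; have -> : restrict [ffun i => f (e i)] g = restrict f [ffun j => e (g j)].
    by apply/ffunP => j; rewrite !ffunE.
  apply: avoidR => [i j|j]; rewrite !ffunE; first by move/e_inj/g_inj.
  by case/setIP: (eR (g j)).
- move=> S /subset_of_size[B BS card_B] C CF; apply/negP => SC.
  have : e @: B \in captured m F f.
    rewrite inE card_imset // card_B eqxx /=; apply/existsP; exists C; rewrite CF /=.
    apply/subsetP => _ /imsetP[_ /imsetP[i iB ->] ->]; apply: (subsetP SC).
    by apply/imsetP; exists i; rewrite ?(subsetP BS) // ffunE.
  by rewrite no_captured inE.
Qed.

(** * Collinear quadruples *)

Definition four_on_line (d n : nat) : {set {ffun 'I_4 -> grid d n}} :=
  [set w : {ffun 'I_4 -> grid d n} | [exists v, [&& primitive v,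
     [forall i, base v (w i) == base v (w ord0)] &
     [forall i : 'I_4, forall j : 'I_4, (i < j) ==> (height v (w i) < height v (w j))]]]].

Lemma four_points_hit (d n K : nat) (f : {ffun 'I_K -> grid d n}) (v b : grid d n) :
  primitive v -> injective f -> 3 < #|[set i | base v (f i) == b]| ->
  exists2 g : {ffun 'I_4 -> 'I_K}, injective g & restrict f g \in four_on_line d n.
Proof.
move=> prim f_inj /card_geqP[s [uniq_s size_s sb]].
pose le (i j : 'I_K) := height v (f i) <= height v (f j).
have le_trans : transitive le by move=> i j k; apply: leq_trans.
pose t := sort le s; have size_t : size t = 4 by rewrite size_sort.
have sorted_t : sorted le t by apply: sort_sorted => i j; apply: leq_total.
have [i0 _] : exists i, i \in s by case: (s) size_s => // i s' _; exists i; rewrite mem_head.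
pose g : {ffun 'I_4 -> 'I_K} := [ffun i : 'I_4 => nth i0 t i].
have base_g i : base v (f (g i)) = b.
  have : g i \in s by rewrite -(mem_sort le) ffunE mem_nth ?size_t.
  by move/sb; rewrite inE => /eqP.
have g_inj : injective g.
  by move=> i j /eqP; rewrite !ffunE nth_uniq ?sort_uniq ?size_t // => /eqP/val_inj.
exists g => //; rewrite inE; apply/existsP; exists v; rewrite prim /=; apply/andP; split.
  by apply/forallP => i; rewrite !restrictE !base_g.
apply/forallP => i; apply/forallP => j; apply/implyP => ij; rewrite !restrictE ltn_neqAle.
apply/andP; split.
  apply: contraTneq ij => eq_height; rewrite -leqNgt leq_eqVlt.
  have eq_fg : f (g i) = f (g j) by apply: height_base_inj prim _ eq_height; rewrite !base_g.
  by rewrite (g_inj _ _ (f_inj _ _ eq_fg)) eqxx.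
have := sorted_leq_nth le_trans (fun i => leqnn _) i0 sorted_t.
by move=> /(_ i j); rewrite !inE size_t !ltn_ord !ffunE => /(_ isT isT (ltnW ij)).
Qed.

Definition ord_add (n : nat) (a : 'I_n) (m : nat) : 'I_n :=
  Ordinal (ltn_pmod (a + m) (leq_ltn_trans (leq0n a) (ltn_ord a))).

Definition ray_point (d n : nat) (b v : grid d n) (k : nat) : grid d n :=
  [ffun i => ord_add (b i) (k * v i)].

Lemma on_ray_point (d n : nat) (b v x : grid d n) (k : nat) :
  on_ray b v k x -> x = ray_point b v k.
Proof. by move=> ray; apply: grid_eq => i; rewrite ffunE /= -ray modn_small. Qed.

Definition ray_params (d n : nat) : finType := (grid d n * (grid d n * ('I_n * 'I_n)))%type.

Definition ray_quadruple (d n c : nat) (p : ray_params d n) : {ffun 'I_4 -> grid d n} :=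
  [ffun i : 'I_4 => ray_point p.1 p.2.1
    (nth 0 [:: 0; nat_of_ord p.2.2.1; nat_of_ord p.2.2.2; c] i)].

(* [c] is the number of steps from the lowest to the highest of the four points. *)
Definition quadruple_params (d n c : nat) : {set ray_params d n} :=
  setX setT (setX [set v in ffun_on [set a : 'I_n | 0 < a & c * a < n]]
    (setX [set a : 'I_n | a < c] [set a : 'I_n | a < c])).

Lemma four_on_line_sub (d n : nat) :
  four_on_line d n \subset
  \bigcup_(c < n | 0 < c) @ray_quadruple d n c @: quadruple_params d n c.
Proof.
apply/subsetP => w; rewrite inE => /existsP[v /and3P[prim /forallP same /forallP incr]].
pose steps (i : 'I_4) := height v (w i) - height v (w ord0).
have height_lt (i j : 'I_4) : i < j -> height v (w i) < height v (w j).
  by move=> ij; have /forallP/(_ j) := incr i; rewrite ij.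
have ray i : on_ray (w ord0) v (steps i) (w i).
  apply: on_ray_height_sub => //; first by rewrite (eqP (same i)).
  have [i0|i_gt0] := posnP i; last exact/ltnW/height_lt.
  by rewrite (_ : i = ord0) //; apply: val_inj.
pose o1 : 'I_4 := Ordinal (isT : 1 < 4); pose o2 : 'I_4 := Ordinal (isT : 2 < 4).
pose c := steps ord_max.
have [lt01 lt12 lt23] : [/\ height v (w ord0) < height v (w o1),
    height v (w o1) < height v (w o2) & height v (w o2) < height v (w ord_max)].
  by split; apply: height_lt.
have [c_gt0 steps1_lt steps2_lt] : [/\ 0 < c, steps o1 < c & steps o2 < c].
  by rewrite /c /steps; split; lia.
have span i : c * v i < n.
  by apply: leq_ltn_trans (ltn_ord (w ord_max i)); rewrite ray leq_addl.
have cn : c < n.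
  pose i0 := Ordinal (primitive_dim_gt0 prim); apply: leq_ltn_trans (span i0).
  by rewrite leq_pmulr ?primitive_gt0.
apply/bigcupP; exists (Ordinal cn) => //; apply/imsetP.
exists (w ord0, (v, (Ordinal (ltn_trans steps1_lt cn), Ordinal (ltn_trans steps2_lt cn)))).
  rewrite !in_setX in_setT !inE /= steps1_lt steps2_lt !andbT.
  by apply/ffun_onP => i; rewrite inE primitive_gt0 // span.
apply/ffunP => i; rewrite ffunE {1}(on_ray_point (ray i)); congr (ray_point _ _ _).
case: i => -[|[|[|[|//]]]] lt_i4 /=; last 3 first.
- by congr steps; apply: val_inj.
- by congr steps; apply: val_inj.
- by rewrite /c; congr steps; apply: val_inj.
- by rewrite /steps (_ : Ordinal lt_i4 = ord0) ?subnn //; apply: val_inj.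
Qed.

Lemma card_quadruple_params (d n c : nat) : 0 < c ->
  #|quadruple_params d n c| <= n ^ d * ((n %/ c) ^ d * c ^ 2).
Proof.
move=> c_gt0; rewrite !cardsX cardsT card_grid cardsE card_ffun_on card_ord leq_mul2l.
apply/orP; right; rewrite leq_mul ?leq_wexp2r //; last by rewrite -mulnn leq_mul ?card_ord_lt.
apply: (@leq_card_ord _ _ _ predn) => [i j|i]; rewrite !inE.
  by move=> /andP[i_gt0 _] /andP[j_gt0 _] eq_pred; apply: val_inj => /=; lia.
by move=> /andP[i_gt0 /ltnW ci]; rewrite prednK // leq_divRL // mulnC.
Qed.

Lemma harmonic_sum_le (n l : nat) : \sum_(1 <= c < 2 ^ l) n %/ c <= n * l.
Proof.
elim: l => [|l IH]; first by rewrite big_geq.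
rewrite (big_cat_nat (n := 2 ^ l)) /= ?expn_gt0 ?leq_exp2l // mulnS addnC leq_add //.
apply: (@leq_trans (\sum_(2 ^ l <= c < 2 ^ l.+1) n %/ 2 ^ l)).
  rewrite big_nat [leqRHS]big_nat; apply: leq_sum => c /andP[c_ge _].
  by apply: leq_div2l; rewrite ?expn_gt0.
by rewrite sum_nat_const_nat expnS mul2n -addnn addnK mulnC leq_divM.
Qed.

Lemma card_four_on_line (n l : nat) : n <= 2 ^ l -> #|four_on_line 3 n| <= n ^ 6 * l.
Proof.
move=> nl; apply: leq_trans (subset_leq_card (four_on_line_sub _ _)) _.
apply: leq_trans (leq_card_bigcup _ _) _.
apply: (@leq_trans (\sum_(c < n | 0 < c) n ^ 5 * (n %/ c))).
  apply: leq_sum => c c_gt0; apply: leq_trans (leq_imset_card _ _) _.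
  apply: leq_trans (card_quadruple_params _ _ c_gt0) _.
  have -> : (n %/ c) ^ 3 * c ^ 2 = (n %/ c * c) ^ 2 * (n %/ c).
    by rewrite expnMn mulnAC -expnSr.
  rewrite mulnA leq_mul2r (expnD n 3 2) leq_mul2l leq_wexp2r ?orbT //; exact: leq_divM.
rewrite -big_distrr (expnSr n 5) -mulnA leq_mul2l; apply/orP; right.
apply: leq_trans (harmonic_sum_le n l).
rewrite -(big_geq_mkord 1 n xpredT (fun c => n %/ c)) /=.
case: (posnP n) => [->|n_gt0]; first by rewrite big_geq.
by rewrite [leqRHS](big_cat_nat (n := n)) //= leq_addr.
Qed.

(** * A sparse point set rich in exact triples *)

Lemma pow_self_le_fact (m : nat) : m ^ m <= 4 ^ m * m`!.
Proof.
apply: (@leq_trans ((2 * m) ^_ m)).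
  rewrite ffact_prod -[X in _ ^ X]card_ord -prod_nat_const; apply: leq_prod => i _.
  by have := ltn_ord i; lia.
rewrite -bin_ffact leq_mul2r (_ : 4 = 2 ^ 2) // -expnM -[2 * m]card_ord -card_draws.
by rewrite -[X in _ ^ X]cardsT -card_powerset powersetT subset_leq_card ?subsetT ?orbT.
Qed.

Lemma binomial_union_bound (K m f n M : nat) :
  4 * f <= 2 ^ m -> 8 * (K * n) <= m * M -> 4 * ('C(K, m) * (f * n ^ m)) <= M ^ m.
Proof.
move=> few dense.
have mm_gt0 : 0 < m ^ m by case: m {few dense} => // m; rewrite expn_gt0.
rewrite -(leq_pmul2l mm_gt0).
have ffact_le : K ^_ m <= K ^ m.
  rewrite ffact_prod -[X in _ <= _ ^ X]card_ord -prod_nat_const.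
  by apply: leq_prod => i _; apply: leq_subr.
have binomial_le : 'C(K, m) * m ^ m <= 4 ^ m * K ^ m.
  apply: leq_trans (leq_mul (leqnn _) (pow_self_le_fact m)) _.
  by rewrite mulnCA bin_ffact leq_mul2l ffact_le orbT.
have := leq_wexp2r m dense; rewrite !expnMn; apply: leq_trans.
have := leq_mul (leq_mul few binomial_le) (leqnn (n ^ m)); rewrite (expnMn 2 4).
by move: (2 ^ m) (4 ^ m) (K ^ m) (n ^ m) (m ^ m) 'C(K, m) => a b c x y z; lia.
Qed.

Lemma fingerprint_count_le : exists A, forall q l, 0 < l -> q <= 2 ^ l ->
  fingerprint_count q ^ (47 * l) <= 2 ^ (A * (l ^ 2 * q ^ 5)).
Proof.
exists (10 * (2 * 576 * 47)) => q l l_gt0 ql.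
have base_le : (q ^ 9).+1 <= 2 ^ (10 * l).
  apply: leq_trans (_ : (2 ^ (9 * l)).+1 <= _).
    by rewrite ltnS [9 * l]mulnC expnM leq_wexp2r.
  by rewrite ltn_exp2l // ltn_mul2r l_gt0.
rewrite /fingerprint_count -expnM; apply: leq_trans (leq_wexp2r _ base_le) _.
rewrite -expnM leq_exp2l //; apply: eq_leq.
by rewrite (expnS l 1) expn1; move: (q ^ 5) => p; lia.
Qed.

Lemma sparse_quadruples (q l N : nat) : 0 < l -> q <= 2 ^ l -> 8 * l * N <= q ^ 6 ->
  16 * (2 * N) ^ 3 * #|four_on_line 3 (q ^ 3)| <= #|grid 3 (q ^ 3)| ^ 4.
Proof.
move=> l_gt0 ql few; have nl : q ^ 3 <= 2 ^ (3 * l) by rewrite [3 * l]mulnC expnM leq_wexp2r.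
apply: leq_trans (leq_mul (leqnn _) (card_four_on_line nl)) _.
have -> : #|grid 3 (q ^ 3)| ^ 4 = (q ^ 6) ^ 3 * (q ^ 3) ^ 6.
  by rewrite card_grid -!expnM -expnD.
have cubed : 16 * (2 * N) ^ 3 * (3 * l) <= (q ^ 6) ^ 3.
  apply: leq_trans (leq_wexp2r 3 few); rewrite !expnMn.
  have : l <= l ^ 3 by rewrite -{1}(expn1 l) leq_pexp2l.
  by move: (N ^ 3) (l ^ 3) => x y; nia.
rewrite mulnCA mulnA [X in X <= _](_ : _ = 16 * (2 * N) ^ 3 * (3 * l) * (q ^ 3) ^ 6).
  by rewrite leq_mul2r cubed orbT.
by move: ((q ^ 3) ^ 6) ((2 * N) ^ 3) => x y; lia.
Qed.

Lemma exists_sampled_grid : exists c, forall q l N, 0 < N -> 0 < l -> q <= 2 ^ l ->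
  8 * l * N <= q ^ 6 ->
  exists h : {ffun 'I_N -> grid 3 (q ^ 3)}, [/\ injective h,
    forall g : {ffun 'I_4 -> 'I_N}, injective g -> restrict h g \notin four_on_line 3 (q ^ 3) &
    forall S : {set 'I_N}, c * (l ^ 2 * q ^ 5) <= #|S| -> ~~ line_free (h @: S)].
Proof.
have [A count_le] := fingerprint_count_le.
exists (A + 194) => q l N N_gt0 l_gt0 ql few; set m := (A + 194) * _.
have q_gt0 : 0 < q by case: q few {ql m} => //; rewrite exp0n //; nia.
have [F [card_F small cover]] := grid_containers q_gt0 ql.
have cardT : #|grid 3 (q ^ 3)| = q ^ 9 by rewrite card_grid -expnM.
have N_le : N <= q ^ 6 by nia.
have lq_gt0 : 0 < l ^ 2 * q ^ 5 by rewrite muln_gt0 !expn_gt0 q_gt0 l_gt0.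
have [|||h [h_inj no_four escapes]] := @random_selection (grid 3 (q ^ 3)) _ ord0 N m
  (12 * q ^ 8) (four_on_line 3 (q ^ 3)) F N_gt0 _ _ small.
- by rewrite card_ord; apply: sparse_quadruples few.
- have q_gt1 : 1 < q.
    by rewrite ltnNge; apply/negP => q_le1; have := leq_wexp2r 6 q_le1; rewrite exp1n; nia.
  have : 2 ^ 3 <= q ^ 3 by rewrite leq_exp2r.
  by rewrite cardT (expnD q 6 3); move: (q ^ 6) (q ^ 3) few => a b; nia.
- rewrite cardT; apply: binomial_union_bound.
    apply: leq_trans (leq_mul (leqnn 4) (leq_trans card_F (count_le _ _ l_gt0 ql))) _.
    rewrite (_ : 4 = 2 ^ 2) // -expnD leq_exp2l // /m mulnDl.
    by move: (l ^ 2 * q ^ 5) lq_gt0 => x; lia.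
  have m_ge : 194 * q ^ 5 <= m.
    by rewrite /m leq_mul ?leq_addl // leq_pmull // expn_gt0 l_gt0.
  have mq_ge : 192 * N <= m * q by rewrite (expnSr q 5) in N_le; nia.
  have := leq_mul mq_ge (leqnn (q ^ 8)); rewrite (expnS q 8).
  by move: (q ^ 8) => x; lia.
exists h; split=> // S /escapes escape; apply/negP => free.
by have [C CF hSC] := cover _ (subsetT _) free; move: (escape _ CF); rewrite hSC.
Qed.

Lemma exact_line_of_not_line_free (d n N : nat) (h : {ffun 'I_N -> grid d n})
    (S : {set 'I_N}) :
  injective h ->
  (forall g : {ffun 'I_4 -> 'I_N}, injective g -> restrict h g \notin four_on_line d n) ->
  ~~ line_free (h @: S) ->
  exists v b, [/\ primitive v, #|[set t | base v (h t) == b]| = 3 &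
    [set t | base v (h t) == b] \subset S].
Proof.
move=> h_inj no_four; rewrite negb_forall => /existsP[v].
rewrite negb_imply negb_forall => /andP[prim /existsP[b]]; rewrite -ltnNge => rich.
exists v, b; set line := [set t | _]; set hit := [set x in _ | _] in rich.
have line_le3 : #|line| <= 3.
  rewrite leqNgt; apply/negP => /(four_points_hit prim h_inj)[g g_inj].
  by apply/negP; apply: no_four.
have hit_sub : hit \subset h @: line.
  apply/subsetP => x; rewrite inE => /andP[/imsetP[t _ ->] bt].
  by apply: imset_f; rewrite inE.
have card_hit : #|hit| <= #|line| by rewrite -(card_imset _ h_inj) subset_leq_card.
have hitE : hit = h @: line.
  by apply/eqP; rewrite eqEcard hit_sub card_imset // (leq_trans line_le3).
split=> //; first by apply/eqP; rewrite eqn_leq line_le3 (leq_trans rich).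
apply/subsetP => t tL; have : h t \in hit by rewrite hitE imset_f.
by rewrite inE => /andP[/imsetP[t' t'S /h_inj->]].
Qed.

Lemma In_mem (s : seq nat) (x : nat) : List.In x s <-> x \in s.
Proof.
elim: s => [|y s IH] //=; rewrite inE; split=> [[->|/IH->]|/orP[/eqP->|/IH]].
- by rewrite eqxx.
- by rewrite orbT.
- by left.
- by right.
Qed.

Lemma NoDup_uniq (s : seq nat) : List.NoDup s -> uniq s.
Proof.
elim=> [//|x t notin _ IH] /=; rewrite IH andbT.
by apply/negP => /In_mem.
Qed.

Section Transfer.
Variables (d n N : nat) (h : {ffun 'I_N -> grid d n}).
Hypothesis h_inj : injective h.

Definition sample_point (i : nat) : nat -> Z :=
  if insub i is Some o then zcoords (h o) else fun=> 0%Z.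

Lemma sample_point_ord (o : 'I_N) : sample_point o = zcoords (h o).
Proof. by rewrite /sample_point valK. Qed.

Lemma distinct_sample_points : distinct_points d N sample_point.
Proof.
move=> i j /ltP iN /ltP jN.
rewrite (sample_point_ord (Ordinal iN)) (sample_point_ord (Ordinal jN)) => eq_coords.
suff : Ordinal iN = Ordinal jN by case.
apply/h_inj/grid_eq => a; have := eq_coords a (elimT ltP (ltn_ord a)).
by rewrite !zcoords_ord; apply: Nat2Z.inj.
Qed.

Lemma exact_line_triple (v b : grid d n) :
  primitive v -> #|[set t | base v (h t) == b]| = 3 ->
  exists i j k : 'I_N, [/\ base v (h i) = b, base v (h j) = b, base v (h k) = b &
    exact_triple d N sample_point i j k].
Proof.
set line := [set t | _] => prim line3.
have /card_gt2P[i [j [k [[iL jL kL] [ij jk ki]]]]] : 2 < #|line| by rewrite line3.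
have lineE : [set i; j; k] = line.
  apply/eqP; rewrite eqEcard line3 (eqP (_ : #|[set i; j; k]| == 3)) ?cards3; last first.
    by rewrite ij jk eq_sym ki.
  rewrite andbT; apply/subsetP => t.
  by rewrite in_setU in_set2 in_set1 -orbA => /or3P[] /eqP->.
have [/eqP bi /eqP bj /eqP bk] : [/\ base v (h i) == b, base v (h j) == b & base v (h k) == b].
  by move: iL jL kL; rewrite !inE.
exists i, j, k; split=> //; split; first by split; [|split]; apply/ltP/ltn_ord.
split; first by split; [|split] => /val_inj eq_ord; move: ij jk ki; rewrite eq_ord eqxx.
rewrite !sample_point_ord; split; first by apply: (base_collinear prim); rewrite ?bi ?bj.
move=> t /ltP tN; rewrite (sample_point_ord (Ordinal tN)) => col.
have : Ordinal tN \in [set i; j; k].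
  by rewrite lineE inE (collinear_base prim _ _ col) ?bi ?bj ?eqxx ?(inj_eq h_inj).
by rewrite !inE -orbA => /or3P[] /eqP /(congr1 val) /= ->; tauto.
Qed.

End Transfer.

Theorem exists_exact_triples : exists c : nat, forall q l N : nat,
  (1 <= N)%coq_nat -> (1 <= l)%coq_nat -> (q <= Nat.pow 2 l)%coq_nat ->
  (8 * l * N <= Nat.pow q 6)%coq_nat ->
  exists P : nat -> nat -> Z, distinct_points 3 N P /\
    forall S : list nat, List.NoDup S -> (forall i, List.In i S -> (i < N)%coq_nat) ->
      (c * (l * l * Nat.pow q 5) <= length S)%coq_nat ->
      exists i j k, (List.In i S /\ List.In j S /\ List.In k S) /\ exact_triple 3 N P i j k.
Proof.
have powE a b : Nat.pow a b = expn a b by elim: b => //= b IH; rewrite expnS IH.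
have [c sample] := exists_sampled_grid; exists c => q l N /leP N_gt0 /leP l_gt0.
rewrite !powE => /leP ql /leP few.
have [h [h_inj no_four dense]] := sample q l N N_gt0 l_gt0 ql few.
exists (sample_point h); split; first exact: distinct_sample_points.
move=> S /NoDup_uniq uniq_S SN /leP large.
pose A := [set i : 'I_N | nat_of_ord i \in S].
have card_A : size S <= #|A|.
  rewrite cardE -(size_map val); apply: uniq_leq_size => // i iS.
  have /ltP iN : (i < N)%coq_nat by apply/SN/In_mem.
  by apply/mapP; exists (Ordinal iN); rewrite // mem_enum inE.
have [|v [b [prim line3 lineA]]] := exact_line_of_not_line_free h_inj no_four (dense A _).
  by rewrite (leq_trans _ card_A) // -mulnn.
have [i [j [k [bi bj bk exact]]]] := exact_line_triple h_inj prim line3.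
have inS (o : 'I_N) : base v (h o) = b -> List.In (o : nat) S.
  move=> bo; apply/In_mem; have /(subsetP lineA) : o \in [set t | base v (h t) == b].
    by rewrite inE bo.
  by rewrite inE.
by exists i, j, k; split=> //; split; [|split]; apply: inS.
Qed.

End GridTriples.

(** * Generic projection to the plane *)

Lemma bounded_family (N : nat) (f : nat -> Z) :
  exists B : Z, (0 <= B)%Z /\ forall i, (i < N)%nat -> (Z.abs (f i) <= B)%Z.
Proof.
  induction N as [|N [B [B_ge0 f_le]]].
  - exists 0%Z; split; [lia | intros i lt_i; lia].
  - exists (Z.max B (Z.abs (f N))); split; [lia|].
    intros i lt_i; destruct (Nat.eq_dec i N) as [->|]; [lia|].
    specialize (f_le i ltac:(lia)); lia.
Qed.

Lemma base_expansion_zero (T a b c : Z) :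
  (Z.abs a < T)%Z -> (Z.abs b < T)%Z -> (Z.abs c < T)%Z ->
  (a + T * b + T * T * c = 0)%Z -> a = 0%Z /\ b = 0%Z /\ c = 0%Z.
Proof.
  intros a_lt b_lt c_lt expansion.
  assert (a_mul : (a = T * - (b + T * c))%Z) by lia.
  assert (b + T * c = 0)%Z by nia.
  assert (c = 0)%Z by nia.
  subst; lia.
Qed.

Definition minor (x y : nat -> Z) (i j k : nat) : Z :=
  ((x j - x i) * (y k - y i) - (x k - x i) * (y j - y i))%Z.

Definition coord (P : nat -> nat -> Z) (a i : nat) : Z := P i a.

Lemma collinear3_minor (P : nat -> nat -> Z) (i j k : nat) :
  collinear 3 (P i) (P j) (P k) <->
  minor (coord P 0) (coord P 1) i j k = 0%Z /\ minor (coord P 0) (coord P 2) i j k = 0%Z /\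
  minor (coord P 1) (coord P 2) i j k = 0%Z.
Proof.
  unfold collinear, minor, coord; split.
  - intros col; repeat split.
    + specialize (col 0%nat 1%nat ltac:(lia) ltac:(lia)); lia.
    + specialize (col 0%nat 2%nat ltac:(lia) ltac:(lia)); lia.
    + specialize (col 1%nat 2%nat ltac:(lia) ltac:(lia)); lia.
  - intros (minor01 & minor02 & minor12) a b lt_a lt_b.
    destruct a as [|[|[|a]]], b as [|[|[|b]]]; lia.
Qed.

(* [proj_y] is the derivative of [proj_x] with respect to [T], so that the minor
   below expands in base [T] with the three coordinate minors as digits. *)
Definition proj_x (T : Z) (P : nat -> nat -> Z) (i : nat) : Z :=
  (P i 0%nat + T * P i 1%nat + T * T * P i 2%nat)%Z.

Definition proj_y (T : Z) (P : nat -> nat -> Z) (i : nat) : Z :=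
  (P i 1%nat + 2 * T * P i 2%nat)%Z.

Lemma minor_proj (T : Z) (P : nat -> nat -> Z) (i j k : nat) :
  minor (proj_x T P) (proj_y T P) i j k =
  (minor (coord P 0) (coord P 1) i j k + T * (2 * minor (coord P 0) (coord P 2) i j k)
   + T * T * minor (coord P 1) (coord P 2) i j k)%Z.
Proof. unfold minor, proj_x, proj_y, coord; ring. Qed.

Lemma minor_bound (B : Z) (x y : nat -> Z) (i j k : nat) :
  (forall t, t = i \/ t = j \/ t = k -> (Z.abs (x t) <= B)%Z /\ (Z.abs (y t) <= B)%Z) ->
  (Z.abs (minor x y i j k) <= 8 * (B * B))%Z.
Proof.
  intros le_B.
  assert (mul_bound : forall a b, (Z.abs a <= 2 * B -> Z.abs b <= 2 * B ->
    Z.abs (a * b) <= 4 * (B * B))%Z) by (intros a b a_le b_le; rewrite Z.abs_mul; nia).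
  destruct (le_B i ltac:(auto)), (le_B j ltac:(auto)), (le_B k ltac:(auto)).
  pose proof (mul_bound (x j - x i) (y k - y i) ltac:(lia) ltac:(lia))%Z.
  pose proof (mul_bound (x k - x i) (y j - y i) ltac:(lia) ltac:(lia))%Z.
  unfold minor; lia.
Qed.

Theorem generic_projection (N : nat) (P : nat -> nat -> Z) :
  distinct_points 3 N P ->
  exists X Y : nat -> Z,
    (forall i j, (i < N)%nat -> (j < N)%nat -> X i = X j -> i = j) /\
    forall i j k, (i < N)%nat -> (j < N)%nat -> (k < N)%nat ->
      minor X Y i j k = 0%Z <-> collinear 3 (P i) (P j) (P k).
Proof.
  intros distinct.
  pose (norm1 i := (Z.abs (P i 0%nat) + Z.abs (P i 1%nat) + Z.abs (P i 2%nat))%Z).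
  destruct (bounded_family N norm1) as [B [B_ge0 norm1_le]].
  assert (coord_le : forall i a, (i < N)%nat -> (a < 3)%nat -> (Z.abs (coord P a i) <= B)%Z).
  { intros i a lt_i lt_a; specialize (norm1_le i lt_i); unfold norm1, coord in *.
    destruct a as [|[|[|a]]]; lia. }
  set (T := (16 * (B * B) + 2 * B + 1)%Z).
  exists (proj_x T P), (proj_y T P); split.
  - intros i j lt_i lt_j eq_proj.
    assert (digit : forall a, (a < 3)%nat -> (Z.abs (coord P a i - coord P a j) < T)%Z).
    { intros a lt_a; pose proof (coord_le i a lt_i lt_a); pose proof (coord_le j a lt_j lt_a).
      unfold T; nia. }
    destruct (base_expansion_zero T (coord P 0 i - coord P 0 j)
      (coord P 1 i - coord P 1 j) (coord P 2 i - coord P 2 j))%Z as (diff0 & diff1 & diff2);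
      try (apply digit; lia).
    + unfold proj_x, coord in *; lia.
    + apply distinct; trivial; intros a lt_a.
      destruct a as [|[|[|a]]]; unfold coord in *; lia.
  - intros i j k lt_i lt_j lt_k; rewrite collinear3_minor, minor_proj.
    assert (digit : forall a b, (a < 3)%nat -> (b < 3)%nat ->
      (Z.abs (2 * minor (coord P a) (coord P b) i j k) < T)%Z).
    { intros a b lt_a lt_b.
      enough (Z.abs (minor (coord P a) (coord P b) i j k) <= 8 * (B * B))%Z by (unfold T; lia).
      apply minor_bound; intros t [-> | [-> | ->]]; auto. }
    pose proof (digit 0 1 ltac:(lia) ltac:(lia))%nat.
    pose proof (digit 0 2 ltac:(lia) ltac:(lia))%nat.
    pose proof (digit 1 2 ltac:(lia) ltac:(lia))%nat.
    split.
    + intros expansion; apply base_expansion_zero in expansion; lia.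
    + intros (-> & -> & ->); lia.
Qed.

(** * Triangular cells *)

Definition side (l : line) (p : pt) : R := la l * fst p + lb l * snd p - lc l.

Lemma on_line_side (l : line) (p : pt) : on_line l p <-> side l p = 0.
Proof. unfold on_line, side; split; intros; lra. Qed.

Lemma same_cell_side (L : list line) (p q : pt) (i : nat) :
  (i < length L)%nat -> same_cell L p q -> 0 < side (lin L i) p * side (lin L i) q.
Proof.
  intros lt_i (_ & _ & g & cont1 & cont2 & g0 & g1 & off).
  apply Rnot_le_lt; intros opposite.
  pose (phi := fun t => side (lin L i) (g t)).
  assert (cont : continuity phi).
  { intros t; unfold phi, side.
    apply continuity_pt_minus; [|apply continuity_pt_const; intros ? ?; reflexivity].
    apply continuity_pt_plus; apply continuity_pt_mult;
      try (apply continuity_pt_const; intros ? ?; reflexivity); [apply cont1 | apply cont2]. }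
  destruct (IVT_cor phi 0 1 cont ltac:(lra)) as [z [z_range z_root]].
  { unfold phi; rewrite g0, g1; exact opposite. }
  apply (off z z_range i lt_i), on_line_side, z_root.
Qed.

Lemma side_lipschitz (l : line) (p q : pt) (r : R) :
  Rabs (fst p - fst q) < r -> Rabs (snd p - snd q) < r ->
  Rabs (side l p - side l q) <= (Rabs (la l) + Rabs (lb l)) * r.
Proof.
  intros close1 close2; unfold side.
  replace (la l * fst p + lb l * snd p - lc l - (la l * fst q + lb l * snd q - lc l))
    with (la l * (fst p - fst q) + lb l * (snd p - snd q)) by ring.
  eapply Rle_trans; [apply Rabs_triang|]; rewrite !Rabs_mult.
  pose proof (Rabs_pos (la l)); pose proof (Rabs_pos (lb l)); nra.
Qed.

Lemma closure_side (L : list line) (p z : pt) (i : nat) :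
  (i < length L)%nat -> in_closure_cell L p z -> 0 <= side (lin L i) p * side (lin L i) z.
Proof.
  intros lt_i closure; apply Rnot_lt_le; intros opposite.
  set (l := lin L i) in *; set (m := 1 + (Rabs (la l) + Rabs (lb l))).
  assert (m_ge1 : 1 <= m).
  { pose proof (Rabs_pos (la l)); pose proof (Rabs_pos (lb l)); unfold m; lra. }
  assert (z_off : 0 < Rabs (side l z)).
  { apply Rabs_pos_lt; intros z_on; rewrite z_on in opposite; lra. }
  set (r := Rabs (side l z) / m).
  assert (r_pos : 0 < r) by (apply Rdiv_lt_0_compat; lra).
  destruct (closure r r_pos) as [q [cell [close1 close2]]].
  pose proof (same_cell_side L p q i lt_i cell) as same; fold l in same.
  pose proof (side_lipschitz l q z r close1 close2) as lipschitz.
  assert (m_r : m * r = Rabs (side l z)) by (unfold r; field; lra).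
  assert (near : Rabs (side l q - side l z) < Rabs (side l z)) by (unfold m in m_r; lra).
  apply Rabs_def2 in near; unfold Rabs in near; destruct (Rcase_abs (side l z)); nra.
Qed.

Definition det (x y : nat -> R) (i j k : nat) : R :=
  (x j - x i) * (y k - y i) - (x k - x i) * (y j - y i).

(* Dual line of the point [(x i, y i)], pushed off by [e * x i ^ 2]: this opens
   every concurrent triple into a triangle. *)
Definition dual_line (x y : nat -> R) (e : R) (i : nat) : line :=
  mkLine (- x i) 1 (y i + e * x i * x i) (or_intror R1_neq_R0).

Definition dual_arr (N : nat) (x y : nat -> R) (e : R) : list line :=
  map (dual_line x y e) (seq 0 N).

Lemma length_dual_arr N x y e : length (dual_arr N x y e) = N.
Proof. unfold dual_arr; rewrite length_map, length_seq; reflexivity. Qed.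

Lemma lin_dual_arr N x y e i : (i < N)%nat -> lin (dual_arr N x y e) i = dual_line x y e i.
Proof.
  intros lt_i; unfold lin, dual_arr.
  rewrite nth_indep with (d' := dual_line x y e 0)
    by (rewrite length_map, length_seq; exact lt_i).
  rewrite map_nth, seq_nth by exact lt_i; reflexivity.
Qed.

(* Barycentric coordinate of [p], up to the factor [e], with respect to the
   triangle bounded by the dual lines [i], [j], [k]. *)
Definition bary (x y : nat -> R) (e : R) (i j k : nat) (p : pt) : R :=
  - side (dual_line x y e i) p / ((x i - x j) * (x i - x k)).

Section Barycentric.
Variables (x y : nat -> R) (e : R) (i j k : nat).
Hypotheses (neq_ij : x i <> x j) (neq_jk : x j <> x k) (neq_ik : x i <> x k).

Lemma bary_sum (p : pt) :
  bary x y e i j k p + bary x y e j i k p + bary x y e k i j p =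
  e + det x y i j k / ((x j - x i) * (x k - x i) * (x k - x j)).
Proof. unfold bary, side, det; simpl; field; repeat split; lra. Qed.

Lemma side_interpolation (l : nat) (p : pt) : det x y i j k = 0 ->
  (x j - x i) * side (dual_line x y e l) p + det x y i j l =
  (x i - x j) * (bary x y e i j k p * ((x l - x j) * (x l - x k))
    + bary x y e j i k p * ((x l - x i) * (x l - x k))
    + bary x y e k i j p * ((x l - x i) * (x l - x j))).
Proof.
  intros det0.
  assert (yk : y k = y i + (x k - x i) * (y j - y i) / (x j - x i)).
  { unfold det in det0; apply Rmult_eq_reg_l with (x j - x i); [|lra].
    field_simplify; lra. }
  unfold bary, side, det; simpl; rewrite yk; field; repeat split; lra.
Qed.

Lemma triangle_center : det x y i j k = 0 ->
  exists p, bary x y e i j k p = e / 3 /\ bary x y e j i k p = e / 3 /\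
    bary x y e k i j p = e / 3.
Proof.
  intros det0.
  pose (si := - (e / 3 * ((x i - x j) * (x i - x k)))).
  pose (sj := - (e / 3 * ((x j - x i) * (x j - x k)))).
  pose (s := (si - sj + y i - y j + e * (x i * x i - x j * x j)) / (x j - x i)).
  pose (p := (s, si + x i * s + y i + e * x i * x i)).
  assert (bary_i : bary x y e i j k p = e / 3).
  { unfold bary, side, p, si; simpl; field; repeat split; lra. }
  assert (bary_j : bary x y e j i k p = e / 3).
  { unfold bary, side, p, s, si, sj; simpl; field; repeat split; lra. }
  exists p; repeat split; trivial.
  pose proof (bary_sum p) as sum; rewrite det0 in sum; unfold Rdiv in *; lra.
Qed.

End Barycentric.

Lemma bary_closure (N : nat) (x y : nat -> R) (e : R) (i j k : nat) (p z : pt) :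
  (i < N)%nat -> in_closure_cell (dual_arr N x y e) p z ->
  0 < bary x y e i j k p -> 0 <= bary x y e i j k z.
Proof.
  intros lt_i closure p_pos; apply Rnot_lt_le; intros z_neg.
  apply closure_side with (i := i) in closure; [|rewrite length_dual_arr; exact lt_i].
  rewrite lin_dual_arr in closure by exact lt_i; unfold bary in p_pos, z_neg.
  set (v := / ((x i - x j) * (x i - x k))) in *; unfold Rdiv in p_pos, z_neg.
  fold v in p_pos, z_neg.
  pose proof (Rmult_lt_0_compat _ _ p_pos (Ropp_0_gt_lt_contravar _ z_neg)).
  pose proof (Rle_0_sqr v) as sqr; unfold Rsqr in sqr; nra.
Qed.

Section DualArrangement.
Variables (N : nat) (x y : nat -> R) (e W : R).
Hypothesis x_inj : forall i j, (i < N)%nat -> (j < N)%nat -> i <> j -> x i <> x j.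
Hypothesis width : forall i j, (i < N)%nat -> (j < N)%nat -> Rabs (x i - x j) <= W.
Hypothesis det_gap : forall i j k, (i < N)%nat -> (j < N)%nat -> (k < N)%nat ->
  det x y i j k <> 0 -> 1 <= Rabs (det x y i j k).
Hypotheses (e_pos : 0 < e) (e_small : e * W ^ 3 < 1).

Lemma det_zero (i j k : nat) : (i < N)%nat -> (j < N)%nat -> (k < N)%nat ->
  Rabs (det x y i j k) < 1 -> det x y i j k = 0.
Proof.
  intros lt_i lt_j lt_k lt1; apply NNPP; intros nonzero.
  pose proof (det_gap i j k lt_i lt_j lt_k nonzero); lra.
Qed.

Lemma width_mul2 (i j k l : nat) : (i < N)%nat -> (j < N)%nat -> (k < N)%nat -> (l < N)%nat ->
  Rabs ((x i - x j) * (x k - x l)) <= W * W.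
Proof.
  intros; rewrite Rabs_mult; apply Rmult_le_compat; auto using Rabs_pos.
Qed.

Lemma simple_dual_arr : simple_arr (dual_arr N x y e).
Proof.
  split; rewrite length_dual_arr.
  - intros i j lt_i lt_j neq; rewrite !lin_dual_arr by assumption; unfold parallel; simpl.
    intros par; apply (x_inj i j lt_i lt_j neq); lra.
  - intros i j k p lt_i lt_j lt_k ij jk ik; rewrite !lin_dual_arr, !on_line_side by assumption.
    intros (on_i & on_j & on_k).
    pose proof (x_inj i j lt_i lt_j ij) as xij; pose proof (x_inj j k lt_j lt_k jk) as xjk.
    pose proof (x_inj i k lt_i lt_k ik) as xik.
    pose proof (bary_sum x y e i j k xij xjk xik p) as sum.
    unfold bary in sum; rewrite on_i, on_j, on_k in sum.
    set (V := (x j - x i) * (x k - x i) * (x k - x j)) in sum.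
    assert (V_neq0 : V <> 0).
    { unfold V; repeat apply Rmult_integral_contrapositive_currified; lra. }
    assert (det_eq : det x y i j k = - (e * V)).
    { apply Rmult_eq_reg_r with (/ V); [|apply Rinv_neq_0_compat, V_neq0].
      replace (- (e * V) * / V) with (- e) by (field; exact V_neq0).
      unfold Rdiv in sum; lra. }
    assert (V_le : Rabs V <= W * W * W).
    { unfold V; rewrite Rabs_mult; apply Rmult_le_compat; auto using Rabs_pos, width_mul2. }
    assert (det_small : Rabs (det x y i j k) < 1).
    { rewrite det_eq, Rabs_Ropp, Rabs_mult, (Rabs_right e) by lra.
      simpl in e_small; nra. }
    apply det_zero in det_small; trivial.
    apply V_neq0, Rmult_eq_reg_l with e; lra.
Qed.

Section Triangle.
Variables i j k : nat.
Hypotheses (lt_i : (i < N)%nat) (lt_j : (j < N)%nat) (lt_k : (k < N)%nat).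
Hypotheses (ij : i <> j) (jk : j <> k) (ik : i <> k) (concurrent : det x y i j k = 0).

Let xij : x i <> x j := x_inj i j lt_i lt_j ij.
Let xjk : x j <> x k := x_inj j k lt_j lt_k jk.
Let xik : x i <> x k := x_inj i k lt_i lt_k ik.

Lemma triangle_avoids (l : nat) (q : pt) : (l < N)%nat -> det x y i j l <> 0 ->
  0 <= bary x y e i j k q -> 0 <= bary x y e j i k q -> 0 <= bary x y e k i j q ->
  side (dual_line x y e l) q <> 0.
Proof.
  intros lt_l off_l bi_ge0 bj_ge0 bk_ge0 on_l; apply off_l, det_zero; trivial.
  pose proof (bary_sum x y e i j k xij xjk xik q) as sum.
  rewrite concurrent in sum; unfold Rdiv in sum; rewrite Rmult_0_l, Rplus_0_r in sum.
  pose proof (side_interpolation x y e i j k xij xjk xik l q concurrent) as interpolation.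
  rewrite on_l, Rmult_0_r, Rplus_0_l in interpolation; rewrite interpolation.
  revert sum bi_ge0 bj_ge0 bk_ge0; set (bi := bary x y e i j k q).
  set (bj := bary x y e j i k q); set (bk := bary x y e k i j q); intros.
  assert (term : forall b s, 0 <= b -> Rabs s <= W * W -> Rabs (b * s) <= b * (W * W)).
  { intros b s b_ge0 s_le; rewrite Rabs_mult, (Rabs_right b) by lra.
    apply Rmult_le_compat_l; assumption. }
  pose proof (term bi _ bi_ge0 (width_mul2 l j l k lt_l lt_j lt_l lt_k)).
  pose proof (term bj _ bj_ge0 (width_mul2 l i l k lt_l lt_i lt_l lt_k)).
  pose proof (term bk _ bk_ge0 (width_mul2 l i l j lt_l lt_i lt_l lt_j)).
  rewrite Rabs_mult; apply Rle_lt_trans with (W * (e * (W * W))); [|simpl in e_small; lra].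
  apply Rmult_le_compat; auto using Rabs_pos.
  eapply Rle_trans; [apply Rabs_triang|].
  eapply Rle_trans; [apply Rplus_le_compat_r, Rabs_triang|].
  rewrite <- sum; lra.
Qed.

Lemma triangle_cell :
  (forall l, (l < N)%nat -> det x y i j l = 0 -> l = i \/ l = j \/ l = k) ->
  exists p, off_lines (dual_arr N x y e) p /\
    forall S : nat -> Prop, S i -> S j -> S k -> hyperedge_in (dual_arr N x y e) p S.
Proof.
  intros only.
  destruct (triangle_center x y e i j k xij xjk xik concurrent) as (p & bi & bj & bk).
  assert (avoids : forall l q, (l < N)%nat -> ~ (l = i \/ l = j \/ l = k) ->
    0 <= bary x y e i j k q -> 0 <= bary x y e j i k q -> 0 <= bary x y e k i j q ->
    side (dual_line x y e l) q <> 0).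
  { intros l q lt_l other; apply triangle_avoids; auto. }
  assert (bary_off : forall a b c,
    bary x y e a b c p = e / 3 -> side (dual_line x y e a) p <> 0).
  { intros a b c b_eq on; unfold bary in b_eq; rewrite on in b_eq.
    unfold Rdiv in b_eq; rewrite Ropp_0, Rmult_0_l in b_eq; lra. }
  exists p; split.
  - intros l; rewrite length_dual_arr; intros lt_l.
    rewrite lin_dual_arr, on_line_side by exact lt_l.
    destruct (classic (l = i \/ l = j \/ l = k)) as [[-> | [-> | ->]] | other]; eauto.
    apply avoids; trivial; lra.
  - intros S Si Sj Sk l; rewrite length_dual_arr; intros lt_l (a & b & _ & on_l & _ & segment).
    destruct (classic (l = i \/ l = j \/ l = k)) as [[-> | [-> | ->]] | other]; trivial.
    exfalso; specialize (segment 0 ltac:(lra)).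
    replace (fst a + 0 * (fst b - fst a), snd a + 0 * (snd b - snd a)) with a in segment
      by (destruct a; simpl; f_equal; ring).
    rewrite lin_dual_arr in on_l by exact lt_l; apply on_line_side in on_l; revert on_l.
    apply avoids; trivial; apply (bary_closure N) with (p := p); trivial; lra.
Qed.

End Triangle.
End DualArrangement.

Lemma det_IZR (X Y : nat -> Z) (i j k : nat) :
  det (fun t => IZR (X t)) (fun t => IZR (Y t)) i j k = IZR (minor X Y i j k).
Proof. unfold det, minor; rewrite minus_IZR, !mult_IZR, !minus_IZR; reflexivity. Qed.

Lemma det_IZR_gap (X Y : nat -> Z) (i j k : nat) :
  det (fun t => IZR (X t)) (fun t => IZR (Y t)) i j k <> 0 ->
  1 <= Rabs (det (fun t => IZR (X t)) (fun t => IZR (Y t)) i j k).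
Proof.
  rewrite det_IZR, <- abs_IZR; intros nonzero; apply (IZR_le 1).
  enough (minor X Y i j k <> 0)%Z by lia.
  intros zero; apply nonzero; rewrite zero; reflexivity.
Qed.

Lemma exists_width (N : nat) (X : nat -> Z) :
  exists W, 0 <= W /\
    forall i j, (i < N)%nat -> (j < N)%nat -> Rabs (IZR (X i) - IZR (X j)) <= W.
Proof.
  destruct (bounded_family N X) as [B [B_ge0 X_le]].
  exists (IZR (2 * B)); split; [apply IZR_le; lia|].
  intros i j lt_i lt_j; rewrite <- minus_IZR, <- abs_IZR; apply IZR_le.
  pose proof (X_le i lt_i); pose proof (X_le j lt_j); lia.
Qed.

Lemma exists_pos_mul_lt1 (m : R) : 0 <= m -> exists e, 0 < e /\ e * m < 1.
Proof.
  intros m_ge0; exists (/ (m + 1)); split; [apply Rinv_0_lt_compat; lra|].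
  apply Rmult_lt_reg_l with (m + 1); [lra|].
  rewrite <- Rmult_assoc, Rinv_r; lra.
Qed.

Theorem exact_triple_cells (N : nat) (P : nat -> nat -> Z) : distinct_points 3 N P ->
  exists L, length L = N /\ simple_arr L /\
    forall i j k, exact_triple 3 N P i j k ->
      exists p, off_lines L p /\
        forall S : nat -> Prop, S i -> S j -> S k -> hyperedge_in L p S.
Proof.
  intros distinct; destruct (generic_projection N P distinct) as (X & Y & X_inj & col).
  destruct (exists_width N X) as (W & W_ge0 & width).
  destruct (exists_pos_mul_lt1 (W ^ 3)) as (e & e_pos & e_small); [apply pow_le, W_ge0|].
  pose (x i := IZR (X i)); pose (y i := IZR (Y i)).
  assert (x_inj : forall i j, (i < N)%nat -> (j < N)%nat -> i <> j -> x i <> x j).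
  { intros i j lt_i lt_j neq eq_x; apply neq, X_inj; trivial; apply eq_IZR, eq_x. }
  assert (det_col : forall i j k, (i < N)%nat -> (j < N)%nat -> (k < N)%nat ->
    det x y i j k = 0 <-> collinear 3 (P i) (P j) (P k)).
  { intros i j k lt_i lt_j lt_k; rewrite <- (col i j k lt_i lt_j lt_k).
    unfold x, y; rewrite det_IZR.
    split; [apply eq_IZR | intros ->; reflexivity]. }
  assert (det_gap : forall i j k, (i < N)%nat -> (j < N)%nat -> (k < N)%nat ->
    det x y i j k <> 0 -> 1 <= Rabs (det x y i j k)).
  { intros; apply det_IZR_gap; assumption. }
  exists (dual_arr N x y e); split; [apply length_dual_arr|]; split.
  - apply simple_dual_arr with W; assumption.
  - intros i j k ((lt_i & lt_j & lt_k) & (ij & jk & ik) & colinear_ijk & only).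
    apply triangle_cell with W; trivial; [apply det_col; assumption|].
    intros l lt_l zero; apply only; trivial; apply det_col; assumption.
Qed.

(** * Choice of parameters *)

Lemma exists_sixth_root (A : nat) : (1 <= A)%nat ->
  exists q, (A <= q ^ 6)%nat /\ (q ^ 6 <= 64 * A)%nat.
Proof.
  intros A_ge1.
  assert (exists q, (q ^ 6 <= A < (S q) ^ 6)%nat) as [q [le_A lt_A]].
  { clear A_ge1; induction A as [|A [q [le_A lt_A]]].
    - exists 0%nat; simpl; lia.
    - destruct (Nat.lt_ge_cases (S A) (S q ^ 6)) as [lt_SA | ge_SA].
      + exists q; lia.
      + exists (S q); split; [exact ge_SA|].
        apply Nat.le_lt_trans with (S q ^ 6)%nat; [lia|].
        apply Nat.pow_lt_mono_l; lia. }
  exists (S q); split; [lia|].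
  destruct q as [|q]; [simpl in lt_A; lia|].
  apply Nat.le_trans with ((2 * S q) ^ 6)%nat; [apply Nat.pow_le_mono_l; lia|].
  rewrite Nat.pow_mul_l; change (2 ^ 6)%nat with 64%nat; lia.
Qed.

Definition bits (n : nat) : nat := (Nat.log2 n + 3)%nat.

(* The exponent [eps n] is chosen so that [n ^ eps n = slack c n]. *)
Definition slack (c n : nat) : R := 512 * (INR c + 1) * INR (bits n) ^ 3.

Lemma lt_pow2_bits (n : nat) : (4 * n < 2 ^ bits n)%nat.
Proof.
  destruct n as [|n]; [simpl; lia|].
  destruct (Nat.log2_spec (S n) ltac:(lia)) as [_ lt_n]; unfold bits.
  rewrite Nat.pow_add_r; rewrite Nat.pow_succ_r' in lt_n; simpl (2 ^ 3)%nat; lia.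
Qed.

Lemma bits_ge3 (n : nat) : 3 <= INR (bits n).
Proof.
  unfold bits; rewrite plus_INR; pose proof (pos_INR (Nat.log2 n)); simpl (INR 3); lra.
Qed.

Lemma slack_ge1 (c n : nat) : 1 <= slack c n.
Proof.
  unfold slack; pose proof (bits_ge3 n); pose proof (pos_INR c).
  assert (1 <= INR (bits n) ^ 3) by (apply pow_R1_Rle; lra); nra.
Qed.

Lemma sixth_root_le_pow2 (q l n : nat) : (3 <= l)%nat -> (4 * n < 2 ^ l)%nat ->
  (q ^ 6 <= 64 * (8 * l * n))%nat -> (q <= 2 ^ l)%nat.
Proof.
  intros l_ge3 n_lt q_le; apply Nat.nlt_ge; intros q_gt.
  assert (t_lt : ((2 ^ l) ^ 6 < q ^ 6)%nat) by (apply Nat.pow_lt_mono_l; lia).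
  assert (l_lt : (l < 2 ^ l)%nat) by (apply Nat.pow_gt_lin_r; lia).
  assert (t_ge8 : (2 ^ 3 <= 2 ^ l)%nat) by (apply Nat.pow_le_mono_r; lia).
  set (t := (2 ^ l)%nat) in *; change (2 ^ 3)%nat with 8%nat in t_ge8.
  assert (q6_le : (64 * (8 * l * n) <= 128 * (t * t))%nat) by nia.
  assert (pow4_ge : (128 * (t * t) <= t * t * (t * t) * (t * t))%nat).
  { apply Nat.mul_le_mono_r; nia. }
  replace (t ^ 6)%nat with (t * t * (t * t) * (t * t))%nat in t_lt by (simpl; ring).
  lia.
Qed.

Lemma pow5_le_Rpower (q m : R) : 0 < q -> q ^ 6 <= m -> q ^ 5 <= Rpower m (5/6).
Proof.
  intros q_pos le_m; replace (q ^ 5) with (Rpower (q ^ 6) (5/6)).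
  - apply Rle_Rpower_l; [lra | split; [apply pow_lt, q_pos | exact le_m]].
  - rewrite <- !Rpower_pow, Rpower_mult by exact q_pos; f_equal; simpl; lra.
Qed.

Lemma exists_parameters (c n : nat) : (1 <= n)%nat ->
  exists q l : nat, (1 <= l)%nat /\ (q <= 2 ^ l)%nat /\ (8 * l * n <= q ^ 6)%nat /\
    INR (c * (l * l * q ^ 5)) <= slack c n * Rpower (INR n) (5/6).
Proof.
  intros n_ge1; set (l := bits n).
  assert (l_ge3 : (3 <= l)%nat) by (unfold l, bits; lia).
  destruct (exists_sixth_root (8 * l * n)) as [q [q_ge q_le]]; [nia|].
  exists q, l; split; [lia|]; split; [|split; [exact q_ge|]].
  - apply sixth_root_le_pow2 with n; trivial; apply lt_pow2_bits.
  - assert (q_pos : 0 < INR q) by (apply lt_0_INR; destruct q; [simpl in q_ge; nia | lia]).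
    assert (n_pos : 0 < INR n) by (apply lt_0_INR; lia).
    pose proof (bits_ge3 n) as l_ge3R; fold l in l_ge3R.
    set (N56 := Rpower (INR n) (5/6)); assert (N56_pos : 0 < N56) by apply exp_pos.
    assert (q5_le : INR q ^ 5 <= 512 * INR l * N56).
    { apply Rle_trans with (Rpower (512 * INR l * INR n) (5/6)).
      - apply pow5_le_Rpower; [exact q_pos|].
        rewrite <- pow_INR; eapply Rle_trans; [apply le_INR, q_le|].
        rewrite !mult_INR; simpl; lra.
      - rewrite <- Rpower_mult_distr by lra; apply Rmult_le_compat_r; [lra|].
        rewrite <- (Rpower_1 (512 * INR l)) at 2 by lra; apply Rle_Rpower; lra. }
    rewrite !mult_INR, pow_INR; unfold slack; fold l.
    pose proof (pos_INR c) as c_ge0.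
    apply Rle_trans with (INR c * (INR l * INR l * (512 * INR l * N56))).
    + apply Rmult_le_compat_l; [exact c_ge0|]; apply Rmult_le_compat_l; [nra | exact q5_le].
    + assert (0 <= INR l ^ 3 * N56) by (apply Rmult_le_pos; [apply pow_le; lra | lra]).
      simpl in *; nra.
Qed.

Definition captures_cells (L : list line) (m : R) : Prop :=
  forall S : list nat, NoDup S -> (forall i, In i S -> (i < length L)%nat) ->
    m <= INR (length S) -> exists p, off_lines L p /\ hyperedge_in L p (fun i => In i S).

Theorem exists_capturing_arr : exists c : nat, forall n, (1 <= n)%nat ->
  exists L, length L = n /\ simple_arr L /\
    captures_cells L (slack c n * Rpower (INR n) (5/6)).
Proof.
  destruct GridTriples.exists_exact_triples as [c triples]; exists c; intros n n_ge1.
  destruct (exists_parameters c n n_ge1) as (q & l & l_ge1 & q_le & n_le & size_le).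
  destruct (triples q l n n_ge1 l_ge1 q_le n_le) as (P & distinct & dense).
  destruct (exact_triple_cells n P distinct) as (L & <- & simple & cells).
  exists L; split; [reflexivity|]; split; [exact simple|].
  intros S nodup S_lt large.
  destruct (dense S nodup S_lt) as (i & j & k & (iS & jS & kS) & exact_ijk).
  { apply INR_le, (Rle_trans _ _ _ size_le large). }
  destruct (cells i j k exact_ijk) as (p & off & hyper); eauto.
Qed.

Lemma exists_off_line (l : line) : exists p, ~ on_line l p.
Proof.
  pose proof (line_nondeg l) as nondeg.
  destruct (classic (on_line l (0, 0))) as [on0 | off0]; [|eauto].
  exists (la l, lb l); unfold on_line in *; simpl in *; nra.
Qed.

Lemma exists_capturing_arr_le1 (n : nat) (m : R) : (n <= 1)%nat -> 0 < m ->
  exists L, length L = n /\ simple_arr L /\ captures_cells L m.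
Proof.
  intros n_le1 m_pos; exists (repeat dflt_line n); unfold captures_cells, simple_arr.
  rewrite repeat_length; split; [reflexivity|]; split; [split; intros; lia|].
  intros S _ S_lt large; destruct S as [|s S]; [simpl in large; lra|].
  pose proof (S_lt s (or_introl eq_refl)) as s_lt.
  assert (n = 1%nat) as -> by lia; assert (s = 0%nat) as -> by lia.
  destruct (exists_off_line dflt_line) as [p off]; exists p; split.
  - intros i lt_i; simpl in lt_i; replace i with 0%nat by lia; exact off.
  - intros i lt_i _; simpl in lt_i; left; lia.
Qed.

(** * The exponent tends to zero *)

Lemma ln_le_mono (a b : R) : 0 < a -> a <= b -> ln a <= ln b.
Proof.
  intros a_pos [lt | ->]; [left; apply ln_increasing; assumption | right; reflexivity].
Qed.

Lemma ln_le_2_sqrt (a : R) : 0 < a -> ln a <= 2 * sqrt a.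
Proof.
  intros a_pos; pose proof (sqrt_lt_R0 a a_pos) as sqrt_pos.
  rewrite <- (sqrt_sqrt a) at 1 by lra; rewrite ln_mult by exact sqrt_pos.
  pose proof (exp_ineq1_le (ln (sqrt a))) as exp_ge.
  rewrite exp_ln in exp_ge by exact sqrt_pos; lra.
Qed.

Lemma bits_le_ln (n : nat) : (1 <= n)%nat -> INR (bits n) <= 3 + 2 * ln (INR n).
Proof.
  intros n_ge1; unfold bits; rewrite plus_INR; simpl (INR 3).
  destruct (Nat.log2_spec n n_ge1) as [pow_le _]; apply le_INR in pow_le.
  rewrite pow_INR in pow_le; change (INR 2) with 2 in pow_le.
  apply ln_le_mono in pow_le; [|apply pow_lt; lra]; rewrite ln_pow in pow_le by lra.
  pose proof ln_lt_2; pose proof (pos_INR (Nat.log2 n)); nra.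
Qed.

Lemma ln_slack_le (c n : nat) : (1 <= n)%nat -> 1 <= ln (INR n) ->
  ln (slack c n) <= (ln (512 * (INR c + 1)) + 18) * sqrt (ln (INR n)).
Proof.
  intros n_ge1; pose proof (bits_le_ln n n_ge1) as bits_le; set (x := ln (INR n)) in *.
  intros x_ge1; pose proof (bits_ge3 n); pose proof (pos_INR c).
  unfold slack; rewrite ln_mult, ln_pow by (try apply pow_lt; lra).
  assert (sqrt_ge1 : 1 <= sqrt x) by (rewrite <- sqrt_1; apply sqrt_le_1; lra).
  assert (ln_bits : ln (INR (bits n)) <= 6 * sqrt x).
  { apply Rle_trans with (ln (3 * 3 * x)); [apply ln_le_mono; lra|].
    eapply Rle_trans; [apply ln_le_2_sqrt; lra|].
    rewrite sqrt_mult, sqrt_square by lra; lra. }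
  assert (lnC_ge0 : 0 <= ln (512 * (INR c + 1))) by (rewrite <- ln_1; apply ln_le_mono; lra).
  simpl (INR 3); nra.
Qed.

Lemma ln_INR_unbounded (m : R) : exists n0 : nat, forall n, (n0 <= n)%nat -> m < ln (INR n).
Proof.
  destruct (INR_unbounded (exp m)) as [n0 n0_gt]; exists n0; intros n n_ge.
  apply le_INR in n_ge; rewrite <- (ln_exp m).
  apply ln_increasing; [apply exp_pos | lra].
Qed.

Lemma slack_exponent_cv (c : nat) : Un_cv (fun n => ln (slack c n) / ln (INR n)) 0.
Proof.
  intros d d_pos; pose proof (pos_INR c).
  set (K := ln (512 * (INR c + 1)) + 18).
  assert (K_pos : 0 < K).
  { assert (0 <= ln (512 * (INR c + 1))) by (rewrite <- ln_1; apply ln_le_mono; lra).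
    unfold K; lra. }
  destruct (ln_INR_unbounded (1 + (K / d) * (K / d))) as [n0 large].
  exists (S n0); intros n n_ge; specialize (large n ltac:(lia)).
  pose proof (ln_slack_le c n ltac:(lia)) as slack_le; fold K in slack_le.
  set (x := ln (INR n)) in *.
  assert (Kd_pos : 0 < K / d) by (apply Rdiv_lt_0_compat; lra).
  assert (x_gt1 : 1 < x) by nra.
  assert (sqrt_gt : K / d < sqrt x).
  { rewrite <- (sqrt_square (K / d)) by lra; apply sqrt_lt_1; nra. }
  assert (K_lt : K < d * sqrt x).
  { replace K with (d * (K / d)) by (field; lra); apply Rmult_lt_compat_l; lra. }
  assert (ln_slack_ge0 : 0 <= ln (slack c n)).
  { rewrite <- ln_1; apply ln_le_mono; [lra | apply slack_ge1]. }
  unfold Rdist; rewrite Rminus_0_r, Rabs_right.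
  - apply Rmult_lt_reg_r with x; [lra|].
    unfold Rdiv; rewrite Rmult_assoc, Rinv_l by lra.
    rewrite <- (sqrt_sqrt x) at 1 by lra; specialize (slack_le ltac:(lra)); nra.
  - apply Rle_ge, Rmult_le_pos; [exact ln_slack_ge0 | left; apply Rinv_0_lt_compat; lra].
Qed.

Lemma Rpower_slack_exponent (c n : nat) : (1 < n)%nat ->
  Rpower (INR n) (5/6 + ln (slack c n) / ln (INR n)) = slack c n * Rpower (INR n) (5/6).
Proof.
  intros n_gt1; pose proof (slack_ge1 c n).
  assert (ln_pos : 0 < ln (INR n)).
  { rewrite <- ln_1; apply ln_increasing; [lra | apply (lt_INR 1), n_gt1]. }
  rewrite Rpower_plus, Rmult_comm; f_equal; unfold Rpower, Rdiv.
  rewrite Rmult_assoc, Rinv_l, Rmult_1_r by lra; apply exp_ln; lra.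
Qed.

(** * Colorings *)

Definition color_class (col : nat -> nat) (c : nat) (s : list nat) : list nat :=
  filter (fun i => Nat.eqb (col i) c) s.

Lemma length_filter_ltb_succ (col : nat -> nat) (k : nat) (s : list nat) :
  length (filter (fun i => Nat.ltb (col i) (S k)) s) =
  (length (filter (fun i => Nat.ltb (col i) k) s) + length (color_class col k s))%nat.
Proof.
  unfold color_class; induction s as [|i s IH]; [reflexivity|]; simpl filter.
  destruct (Nat.ltb_spec (col i) (S k)), (Nat.ltb_spec (col i) k), (Nat.eqb_spec (col i) k);
    simpl; lia.
Qed.

Lemma length_le_color_classes (col : nat -> nat) (b : R) (k : nat) (s : list nat) :
  (forall i, In i s -> (col i < k)%nat) ->
  (forall c, INR (length (color_class col c s)) <= b) -> INR (length s) <= INR k * b.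
Proof.
  intros col_lt small.
  replace s with (filter (fun i => Nat.ltb (col i) k) s) at 1.
  - clear col_lt; induction k as [|k IH].
    + clear small; induction s as [|i s IH]; [simpl; lra | exact IH].
    + rewrite length_filter_ltb_succ, plus_INR, S_INR; specialize (small k); lra.
  - apply forallb_filter_id, forallb_forall; intros i i_in; apply Nat.ltb_lt, col_lt, i_in.
Qed.

Lemma proper_coloring_nonempty (L : list line) (k : nat) (col : nat -> nat) :
  proper_coloring L k col -> (0 < length L)%nat.
Proof.
  intros [_ no_mono]; destruct L as [|l L]; [exfalso | simpl; lia].
  apply (no_mono (0, 0)); [intros i lt_i; simpl in lt_i; lia|].
  exists 0%nat; intros i lt_i; simpl in lt_i; lia.
Qed.

Lemma proper_coloring_length_le (L : list line) (m : R) (k : nat) (col : nat -> nat) :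
  captures_cells L m -> proper_coloring L k col -> INR (length L) <= INR k * m.
Proof.
  intros captures [col_lt no_mono]; rewrite <- (length_seq (length L) 0) at 1.
  apply (length_le_color_classes col).
  - intros i i_in; apply in_seq in i_in; apply col_lt; lia.
  - intros c; apply Rnot_lt_le; intros large.
    destruct (captures (color_class col c (seq 0 (length L)))) as [p [off hyper]].
    + apply NoDup_filter, seq_NoDup.
    + intros i i_in; apply filter_In in i_in; destruct i_in as [i_in _].
      apply in_seq in i_in; lia.
    + lra.
    + apply (no_mono p off); exists c; intros i lt_i bounds.
      specialize (hyper i lt_i bounds); apply filter_In in hyper; apply Nat.eqb_eq, hyper.
Qed.

Lemma chromatic_lower_bound (L : list line) (eps : R) (k : nat) (col : nat -> nat) :
  captures_cells L (Rpower (INR (length L)) (5/6 + eps)) -> proper_coloring L k col ->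
  Rpower (INR (length L)) (1/6 - eps) <= INR k.
Proof.
  intros captures proper.
  pose proof (proper_coloring_nonempty L k col proper) as nonempty.
  pose proof (proper_coloring_length_le L _ k col captures proper) as length_le.
  set (m := Rpower (INR (length L)) (5/6 + eps)) in *.
  assert (m_pos : 0 < m) by apply exp_pos.
  apply Rmult_le_reg_r with m; [exact m_pos|]; unfold m at 1; rewrite <- Rpower_plus.
  replace (1/6 - eps + (5/6 + eps)) with 1 by lra.
  rewrite Rpower_1; [exact length_le | apply lt_0_INR, nonempty].
Qed.

Theorem theorem2p7 :
  exists eps : nat -> R, Un_cv eps 0 /\
  forall n : nat, exists L : list line,
    length L = n /\ simple_arr L /\
    (forall S : list nat, NoDup S -> (forall i, In i S -> (i < n)%nat) ->
       Rpower (INR n) (5/6 + eps n) <= INR (length S) ->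
       exists p, off_lines L p /\ hyperedge_in L p (fun i => In i S)) /\
    (forall (k : nat) (col : nat -> nat), proper_coloring L k col ->
       Rpower (INR n) (1/6 - eps n) <= INR k).
Proof.
  destruct exists_capturing_arr as [c capturing].
  pose (eps n := ln (slack c n) / ln (INR n)).
  exists eps; split; [apply slack_exponent_cv|]; intros n.
  assert (exists L, length L = n /\ simple_arr L /\
    captures_cells L (Rpower (INR n) (5/6 + eps n))) as (L & <- & simple & captures).
  { destruct (Nat.le_gt_cases n 1) as [n_le1 | n_gt1].
    - apply exists_capturing_arr_le1; [exact n_le1 | apply exp_pos].
    - unfold eps; rewrite Rpower_slack_exponent by exact n_gt1; apply capturing; lia. }
  exists L; split; [reflexivity|]; split; [exact simple|]; split; [exact captures|].
  intros k col; apply chromatic_lower_bound, captures.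
Qed.
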